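(* Let $\mathbf{S}\subseteq2^{[n]}$ be a family of sets with cost function $c:\mathbf{S}\to(0,1]$, where $c(S)$ can be evaluated in time $O(n)$. Suppose that for any $y\in\mathbb{Q}_+^n$ and $\varepsilon>0$ given as input, one can find $S^*\in\mathbf{S}$ with $\sum_{i\in S^*}y_i\geq(1-\varepsilon)\cdot\max\{\frac{1}{c(S)}\sum_{i\in S}y_i : S\in\mathbf{S}\}$ in time $T(n,\varepsilon)$. Then for any given $\delta$ with $n/2\geq\delta>0$, one can find a basic solution $x$ of the LP $$OPT_f=\min\Big\{c^Tx : \sum_{S\in\mathbf{S}}x_S\mathbf{1}_S\geq\mathbf{1},\ x\geq\mathbf{0}\Big\}$$ with cost $c^Tx\leq OPT_f+\delta$ in time $$O\left(\frac{n^4}{\delta^2}\ln\left(\frac{n}{\delta}\right)\right)\cdot\left(\frac{1}{\delta}T(n,\Omega(\delta/n))+n^2\right).$$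
   Context: $\mathbf{1}_S\in\{0,1\}^n$ denotes the characteristic vector of $S$. Running times are measured in the RAM model, where each arithmetic operation has unit cost. $T(n,\Omega(\delta/n))$ denotes $T$ evaluated at accuracy parameter $\varepsilon=c_0\delta/n$ for a suitable absolute constant $c_0>0$. $O(\cdot)$ hides absolute constants. *)

(* Defs.v *)
From mathcomp Require Import all_boot all_order all_algebra.
From mathcomp Require Import reals exp.

Set Implicit Arguments.
Unset Strict Implicit.
Unset Printing Implicit Defensive.

Import Order.TTheory GRing.Theory Num.Theory.
Local Open Scope ring_scope.

(** * Linear programs [min {w^T x : B x >= b}] *)

Definition lp_feasible (R : realType) (p m : nat)
    (B : 'M[R]_(p, m)) (b : 'cV[R]_p) (x : 'cV[R]_m) : Prop :=
  forall i, b i 0 <= (B *m x) i 0.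

Definition lp_cost (R : realType) (m : nat) (w x : 'cV[R]_m) : R :=
  \sum_j w j 0 * x j 0.

(* The rows of the constraints that are not active at [x] are zeroed out. *)
Definition active_rows (R : realType) (p m : nat)
    (B : 'M[R]_(p, m)) (b : 'cV[R]_p) (x : 'cV[R]_m) : 'M[R]_(p, m) :=
  \matrix_(i, j) (if (B *m x) i 0 == b i 0 then B i j else 0).

(* [x] is feasible and, among the constraints active at [x], as many are
   linearly independent as there are variables. *)
Definition basic_solution (R : realType) (p m : nat)
    (B : 'M[R]_(p, m)) (b : 'cV[R]_p) (x : 'cV[R]_m) : Prop :=
  lp_feasible B b x /\ \rank (active_rows B b x) = m.

(* The minimum is required to be attained: for the covering program below this
   says exactly that the program is feasible and that [v] is its value. *)
Definition lp_minimum (R : realType) (p m : nat)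
    (B : 'M[R]_(p, m)) (b : 'cV[R]_p) (w : 'cV[R]_m) (v : R) : Prop :=
  (exists2 x, lp_feasible B b x & lp_cost w x = v) /\
  (forall x, lp_feasible B b x -> v <= lp_cost w x).

(** * The covering program of a set family

    The variables are indexed by ['I_#|F|], the [j]-th one standing for the set
    [member j] of the family [F]. *)

Definition member (n : nat) (F : {set {set 'I_n}}) (j : 'I_#|F|) : {set 'I_n} :=
  enum_val j.

Definition incidence (R : realType) (n : nat) (F : {set {set 'I_n}}) :
    'M[R]_(n, #|F|) :=
  \matrix_(i, j) (i \in member j)%:R.

(* [sum_S x_S 1_S >= 1] on top of [x >= 0] *)
Definition cover_mx (R : realType) (n : nat) (F : {set {set 'I_n}}) :
    'M[R]_(n + #|F|, #|F|) :=
  col_mx (incidence R F) 1%:M.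

Definition cover_rhs (R : realType) (n : nat) (F : {set {set 'I_n}}) :
    'cV[R]_(n + #|F|) :=
  col_mx (const_mx 1) 0.

Definition cost_vec (R : realType) (n : nat) (F : {set {set 'I_n}})
    (c : {set 'I_n} -> R) : 'cV[R]_#|F| :=
  \col_j c (member j).

(** * The optimization subroutine *)

Definition weight (R : realType) (n : nat) (y : 'rV[rat]_n) (S : {set 'I_n}) :
    R :=
  \sum_(i in S) ratr (y 0 i).

(* All the values are nonnegative, hence the default value 0. *)
Definition max_ratio (R : realType) (n : nat) (F : {set {set 'I_n}})
    (c : {set 'I_n} -> R) (y : 'rV[rat]_n) : R :=
  \big[Num.max/0]_(S in F) ((c S)^-1 * weight R y S).

(* Either of two guarantees on the answer is accepted: the first bounds the
   weight of the returned set, the second its weight-to-cost ratio.  As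
   [0 < c <= 1], the first implies the second.  The second is kept because the
   first, when available for all [y] and [e], forces [c S = 1] for every
   nonempty [S] in [F] (take for [y] a unit vector and let [e] tend to 0). *)
Definition near_optimal (R : realType) (n : nat) (F : {set {set 'I_n}})
    (c : {set 'I_n} -> R) (y : 'rV[rat]_n) (e : R) (S : {set 'I_n}) : Prop :=
  S \in F /\
  ((1 - e) * max_ratio F c y <= weight R y S \/
   (1 - e) * max_ratio F c y <= (c S)^-1 * weight R y S).

Definition optimizer (R : realType) (n : nat) (F : {set {set 'I_n}})
    (c : {set 'I_n} -> R) (opt : 'rV[rat]_n -> R -> {set 'I_n}) : Prop :=
  forall (y : 'rV[rat]_n) (e : R),
    (forall i, 0 <= y 0 i) -> 0 < e -> near_optimal F c y e (opt y e).

(** * A random access machine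

    The machine has one memory of natural numbers, which also serve as
    addresses, and one memory of numbers in [R].  Programs are finite pieces of
    syntax whose only constants are natural numbers; in particular they do not
    depend on [n], on the family or on its costs, which can be accessed only
    through the two calls [CCost] and [COpt]. *)

Inductive nexp : Type :=
| NConst of nat
| NLoad of nexp
| NAdd of nexp & nexp
| NSub of nexp & nexp
| NMul of nexp & nexp.

Inductive rexp : Type :=
| ROfNat of nexp
| RLoad of nexp
| RAdd of rexp & rexp
| RSub of rexp & rexp
| RMul of rexp & rexp
| RDiv of rexp & rexp.

Inductive bexp : Type :=
| BLeN of nexp & nexp
| BLeR of rexp & rexp
| BNot of bexp
| BAnd of bexp & bexp.

Inductive com : Type :=
| CSkip
| CStoreN (a v : nexp)
| CStoreR (a : nexp) (v : rexp)
| CSeq (p q : com)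
| CIf (b : bexp) (p q : com)
| CWhile (b : bexp) (p : com)
(* store at address [a] the cost of the set read at address [s] *)
| CCost (s a : nexp)
(* call the optimization subroutine on the vector read at address [y] and on the
   accuracy [e], and write the resulting set at address [s] *)
| COpt (y : nexp) (e : rexp) (s : nexp).

Record state (R : Type) : Type := State { nmem : nat -> nat; rmem : nat -> R }.

Definition upd (V : Type) (m : nat -> V) (a : nat) (v : V) : nat -> V :=
  fun k => if k == a then v else m k.

Fixpoint neval (m : nat -> nat) (e : nexp) : nat :=
  match e with
  | NConst k => k
  | NLoad a => m (neval m a)
  | NAdd e1 e2 => (neval m e1 + neval m e2)%N
  | NSub e1 e2 => (neval m e1 - neval m e2)%N
  | NMul e1 e2 => (neval m e1 * neval m e2)%N
  end.

Fixpoint reval (R : realType) (st : state R) (e : rexp) : R :=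
  match e with
  | ROfNat a => (neval (nmem st) a)%:R
  | RLoad a => rmem st (neval (nmem st) a)
  | RAdd e1 e2 => reval st e1 + reval st e2
  | RSub e1 e2 => reval st e1 - reval st e2
  | RMul e1 e2 => reval st e1 * reval st e2
  | RDiv e1 e2 => reval st e1 / reval st e2
  end.

Fixpoint beval (R : realType) (st : state R) (b : bexp) : bool :=
  match b with
  | BLeN e1 e2 => (neval (nmem st) e1 <= neval (nmem st) e2)%N
  | BLeR e1 e2 => reval st e1 <= reval st e2
  | BNot b1 => ~~ beval st b1
  | BAnd b1 b2 => beval st b1 && beval st b2
  end.

(* Evaluating an expression takes one time unit per operation, memory access or
   constant in it. *)
Fixpoint ntime (e : nexp) : nat :=
  match e with
  | NConst _ => 1
  | NLoad a => (ntime a).+1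
  | NAdd e1 e2 | NSub e1 e2 | NMul e1 e2 => (ntime e1 + ntime e2).+1
  end.

Fixpoint rtime (e : rexp) : nat :=
  match e with
  | ROfNat a | RLoad a => (ntime a).+1
  | RAdd e1 e2 | RSub e1 e2 | RMul e1 e2 | RDiv e1 e2 =>
      (rtime e1 + rtime e2).+1
  end.

Fixpoint btime (b : bexp) : nat :=
  match b with
  | BLeN e1 e2 => (ntime e1 + ntime e2).+1
  | BLeR e1 e2 => (rtime e1 + rtime e2).+1
  | BNot b1 => (btime b1).+1
  | BAnd b1 b2 => (btime b1 + btime b2).+1
  end.

(* A subset of ['I_n] is stored at address [a] as its characteristic vector, in
   the cells [a], ..., [a + n - 1] of the memory of natural numbers. *)
Definition read_set (n : nat) (m : nat -> nat) (a : nat) : {set 'I_n} :=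
  [set i : 'I_n | m (a + i)%N != 0%N].

Definition write_set (n : nat) (m : nat -> nat) (a : nat) (S : {set 'I_n}) :
    nat -> nat :=
  fun k => if (a <= k < a + n)%N
           then nat_of_bool [exists i in S, k == (a + i)%N]
           else m k.

(* [exec F c tc T opt p st st' t]: run from [st], the program [p] halts in the
   state [st'] after [t] time units.  A call [CCost] takes [tc] and a call [COpt]
   with accuracy [e] takes [T n e], besides the evaluation of the arguments.
   There is no transition for a call outside its domain, that is, for the cost
   of a set not in [F], a vector that is not rational and nonnegative, or an
   accuracy that is not positive. *)
Inductive exec (R : realType) (n : nat) (F : {set {set 'I_n}})
    (c : {set 'I_n} -> R) (tc : nat) (T : nat -> R -> nat)
    (opt : 'rV[rat]_n -> R -> {set 'I_n}) :
    com -> state R -> state R -> nat -> Prop :=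
| ExecSkip st : exec F c tc T opt CSkip st st 1
| ExecStoreN a v st :
    exec F c tc T opt (CStoreN a v) st
      (State (upd (nmem st) (neval (nmem st) a) (neval (nmem st) v)) (rmem st))
      (ntime a + ntime v).+1
| ExecStoreR a v st :
    exec F c tc T opt (CStoreR a v) st
      (State (nmem st) (upd (rmem st) (neval (nmem st) a) (reval st v)))
      (ntime a + rtime v).+1
| ExecSeq p q st1 st2 st3 t1 t2 :
    exec F c tc T opt p st1 st2 t1 ->
    exec F c tc T opt q st2 st3 t2 ->
    exec F c tc T opt (CSeq p q) st1 st3 (t1 + t2)
| ExecIf b p q st st' t :
    exec F c tc T opt (if beval st b then p else q) st st' t ->
    exec F c tc T opt (CIf b p q) st st' (btime b + t).+1
| ExecWhileStop b p st :
    ~~ beval st b ->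
    exec F c tc T opt (CWhile b p) st st (btime b).+1
| ExecWhileStep b p st1 st2 st3 t1 t2 :
    beval st1 b ->
    exec F c tc T opt p st1 st2 t1 ->
    exec F c tc T opt (CWhile b p) st2 st3 t2 ->
    exec F c tc T opt (CWhile b p) st1 st3 (btime b + t1 + t2).+1
| ExecCost s a st :
    let S := read_set n (nmem st) (neval (nmem st) s) in
    S \in F ->
    exec F c tc T opt (CCost s a) st
      (State (nmem st) (upd (rmem st) (neval (nmem st) a) (c S)))
      (ntime s + ntime a + tc).+1
| ExecOpt y e s st (v : 'rV[rat]_n) :
    (forall i : 'I_n, rmem st (neval (nmem st) y + i)%N = ratr (v 0 i)) ->
    (forall i, 0 <= v 0 i) ->
    0 < reval st e ->
    exec F c tc T opt (COpt y e s) st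
      (State (write_set (nmem st) (neval (nmem st) s) (opt v (reval st e)))
             (rmem st))
      (ntime y + rtime e + ntime s + T n (reval st e)).+1.

Definition input_state (R : realType) (n : nat) (delta : R) : state R :=
  State (upd (fun=> 0%N) 0 n) (upd (fun=> 0) 0 delta).

(* The output is a sparse vector: cell 0 of the memory of natural numbers holds
   the number [k] of entries; for [l < k], the set of the [l]-th entry is stored
   at address [1 + l * n] and its value in cell [l] of the memory of reals. *)
Definition outputs (R : realType) (n : nat) (F : {set {set 'I_n}})
    (st : state R) (x : 'cV[R]_#|F|) : Prop :=
  let k := nmem st 0%N in
  let entry (l : nat) := read_set n (nmem st) (1 + l * n)%N in
  (forall l, (l < k)%N -> entry l \in F) /\
  (forall j, x j 0 = \sum_(l < k | entry l == member j) rmem st l).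

(* Main.v *)
(* The covering program is solved by multiplicative weights.  With [N = 2 ^ L] of
   order [n / delta], [M = N * N * L] and [m i] the number of times the element
   [i] has been covered, [i] has weight [(1 - 1/N) ^ m i] as long as [m i < M]
   and is discarded afterwards.  Every set returned by the oracle shrinks the
   total weight by a factor [expR (- kappa * cost)], with [kappa] about
   [1 / (N * OPT)]; as long as more than [delta / 4] elements remain, the total
   weight is at least [delta / 4 * (1 - 1/N) ^ M], so the cost spent is at most
   [M * (OPT + delta / 2)].  The last [delta / 4] elements are each paid for by
   one set of cost at most [1].  It is this treatment of the last elements that
   replaces a factor [ln n] by [ln (n / delta)].  Every round increases some
   [m i < M], so there are at most [n * M] of them.

   Each chosen set is at once absorbed, by one pivot of the revised simplex
   method, into a basis of [n] columns (sets and slack columns [- e_i]), in time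
   [O(n ^ 2)] and without increasing the cost; absorbing the excesses
   [m i - M] as slacks at the end gives a basic solution. *)

Require Import Defs.
From mathcomp Require Import all_boot all_order all_algebra.
From mathcomp Require Import reals sequences exp.
From mathcomp Require Import zify ring lra.

Set Implicit Arguments.
Unset Strict Implicit.
Unset Printing Implicit Defensive.

Import Order.TTheory GRing.Theory Num.Theory.
Local Open Scope ring_scope.

(** * A structured language with disjoint arrays *)

(** The relative error of the method is a multiple of [1/N + e], with [e] the oracle accuracy. It
    turns into an absolute error because [OPT <= n]; hence [N >= 16 * n / delta] and
    [e = delta / (16 * n)].

    The oracle accepts only rational vectors, whereas [delta] is real. So the weights are built from
    a natural number [N], found by doubling. Doubling also yields [L], which stands in for a
    logarithm on a machine that cannot compute one.

    In the last phase a set is taken [M] times in a single round, so that all its elements are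
    finished at once; a reserve of [M] kept for every active element pays for it.

    The potential argument and the pivots meet in one exact invariant: the basis satisfies
    [B *m z = m], at a cost no larger than the cost spent. Neither side has to know anything else
    about the other.

    Programs are syntax and their time is part of the claim. They are therefore written in a small
    language whose running time is read off the syntax; only the two loops whose length depends on
    the data are counted by a decreasing measure. The resulting number of rounds, of order
    [n^3 / delta^2 * ln (n / delta)], leaves a factor [n] to spare. *)

Inductive snexp : Type :=
| SC of nat
| SDim
| SN of nat & snexp
| SAdd of snexp & snexp
| SSub of snexp & snexp
| SMul of snexp & snexp.

Inductive srexp : Type :=
| SOfN of snexp
| SR of nat & snexp
| SRAdd of srexp & srexp
| SRSub of srexp & srexp
| SRMul of srexp & srexp
| SRDiv of srexp & srexp.

Inductive sbexp : Type :=
| SLeN of snexp & snexp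
| SLeR of srexp & srexp
| SNot of sbexp.

(** The only loop runs a counter over [0, ..., n - 1], so that the time is a constant times a power
    of [n], up to the calls. The two [CWhile] loops of the algorithm are added around compiled
    pieces in [program]. *)
Inductive scom : Type :=
| SSkip
| SSetN (a : nat) (i v : snexp)
| SSetR (a : nat) (i : snexp) (v : srexp)
| SSeq (p q : scom)
| SIf (b : sbexp) (p q : scom)
| SFor (i : nat) (p : scom)
| SCost (s a : nat)
| SOpt (y : nat) (e : srexp) (s : nat).

Definition dimE : nexp := NLoad (NConst 0).

(* Array [a] occupies the [n * n] cells from address [1 + a * n * n] on (for
   natural numbers, cell [0] being reserved for [n]) or [a * n * n] (for reals).
   A scalar is the entry [0] of its own array. *)
Definition blockE (a : nat) : nexp := NMul (NConst a) (NMul dimE dimE).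
Definition addrN (a : nat) (i : nexp) : nexp :=
  NAdd (NAdd (NConst 1) (blockE a)) i.
Definition addrR (a : nat) (i : nexp) : nexp := NAdd (blockE a) i.

Fixpoint compN (e : snexp) : nexp :=
  match e with
  | SC k => NConst k
  | SDim => dimE
  | SN a i => NLoad (addrN a (compN i))
  | SAdd e1 e2 => NAdd (compN e1) (compN e2)
  | SSub e1 e2 => NSub (compN e1) (compN e2)
  | SMul e1 e2 => NMul (compN e1) (compN e2)
  end.

Fixpoint compR (e : srexp) : rexp :=
  match e with
  | SOfN k => ROfNat (compN k)
  | SR a i => RLoad (addrR a (compN i))
  | SRAdd e1 e2 => RAdd (compR e1) (compR e2)
  | SRSub e1 e2 => RSub (compR e1) (compR e2)
  | SRMul e1 e2 => RMul (compR e1) (compR e2)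
  | SRDiv e1 e2 => RDiv (compR e1) (compR e2)
  end.

Fixpoint compB (b : sbexp) : bexp :=
  match b with
  | SLeN e1 e2 => BLeN (compN e1) (compN e2)
  | SLeR e1 e2 => BLeR (compR e1) (compR e2)
  | SNot b1 => BNot (compB b1)
  end.

Definition scalarE (i : nat) : nexp := addrN i (NConst 0).

Fixpoint compile (p : scom) : com :=
  match p with
  | SSkip => CSkip
  | SSetN a i v => CStoreN (addrN a (compN i)) (compN v)
  | SSetR a i v => CStoreR (addrR a (compN i)) (compR v)
  | SSeq p q => CSeq (compile p) (compile q)
  | SIf b p q => CIf (compB b) (compile p) (compile q)
  | SFor i p =>
      CSeq (CStoreN (scalarE i) (NConst 0))
        (CWhile (BNot (BLeN dimE (NLoad (scalarE i))))
          (CSeq (compile p)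
            (CStoreN (scalarE i) (NAdd (NLoad (scalarE i)) (NConst 1)))))
  | SCost s a => CCost (scalarE s) (addrR a (NConst 0))
  | SOpt y e s => COpt (addrR y (NConst 0)) (compR e) (scalarE s)
  end.

Fixpoint modN (p : scom) : seq nat :=
  match p with
  | SSetN a _ _ => [:: a]
  | SSeq p q | SIf _ p q => modN p ++ modN q
  | SFor i p => i :: modN p
  | SOpt _ _ s => [:: s]
  | _ => [::]
  end.

Fixpoint modR (p : scom) : seq nat :=
  match p with
  | SSetR a _ _ => [:: a]
  | SSeq p q | SIf _ p q => modR p ++ modR q
  | SFor _ p => modR p
  | SCost _ a => [:: a]
  | _ => [::]
  end.

(* The running time of [p] is at most
   [tcoef p * n ^ tdeg p + tcalls p * (tc + T n e)]. *)
Definition loop_overhead : nat := 100.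

Fixpoint tcoef (p : scom) : nat :=
  match p with
  | SSkip => 1
  | SSetN a i v => (ntime (addrN a (compN i)) + ntime (compN v)).+1
  | SSetR a i v => (ntime (addrR a (compN i)) + rtime (compR v)).+1
  | SSeq p q => tcoef p + tcoef q
  | SIf b p q => (btime (compB b)).+1 + (tcoef p + tcoef q)
  | SFor i p => tcoef p + loop_overhead
  | SCost s a => (ntime (scalarE s) + ntime (addrR a (NConst 0))).+1
  | SOpt y e s =>
     (ntime (addrR y (NConst 0)) + rtime (compR e) + ntime (scalarE s)).+1
  end%N.

Fixpoint tdeg (p : scom) : nat :=
  match p with
  | SSeq p q | SIf _ p q => maxn (tdeg p) (tdeg q)
  | SFor _ p => (tdeg p).+1
  | _ => 0
  end%N.

Fixpoint tcalls (p : scom) : nat :=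
  match p with
  | SSeq p q => tcalls p + tcalls q
  | SIf _ p q => maxn (tcalls p) (tcalls q)
  | SFor _ p => tcalls p
  | SCost _ _ | SOpt _ _ _ => 1
  | _ => 0
  end%N.

Record astate (R : Type) : Type :=
  AState { an : nat -> nat -> nat; ar : nat -> nat -> R }.

(* [Nat.eqb] rather than [==]: [simpl] then decides equality of literal names. *)
Definition upd2 (V : Type) (m : nat -> nat -> V) (a i : nat) (v : V) :
    nat -> nat -> V :=
  fun b => if Nat.eqb b a then upd (m b) i v else m b.

Definition setN (R : Type) (A : astate R) (a i v : nat) : astate R :=
  AState (upd2 (an A) a i v) (ar A).

Definition setR (R : Type) (A : astate R) (a i : nat) (v : R) : astate R :=
  AState (an A) (upd2 (ar A) a i v).

Lemma upd2_eq (V : Type) (m : nat -> nat -> V) a i v j :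
  upd2 m a i v a j = if j == i then v else m a j.
Proof. by rewrite /upd2 PeanoNat.Nat.eqb_refl. Qed.

Lemma upd2_neq (V : Type) (m : nat -> nat -> V) a i v b :
  b != a -> upd2 m a i v b = m b.
Proof. by rewrite /upd2; case: PeanoNat.Nat.eqb_spec => // -> /eqP. Qed.

Definition frame (R : Type) (p : scom) (A A' : astate R) : Prop :=
  (forall a, a \notin modN p -> an A' a = an A a) /\
  (forall a, a \notin modR p -> ar A' a = ar A a).

(** * Correctness and running time of compiled programs *)

Section Run.

Variables (R : realType) (n : nat) (F : {set {set 'I_n}}).
Variables (c : {set 'I_n} -> R) (tc : nat) (T : nat -> R -> nat).
Variables (opt : 'rV[rat]_n -> R -> {set 'I_n}) (e0 : R).
Hypothesis n_gt0 : (0 < n)%N.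

Notation size := (n * n)%N.
Notation exec := (exec F c tc T opt).

Fixpoint evN (A : astate R) (e : snexp) : nat :=
  match e with
  | SC k => k
  | SDim => n
  | SN a i => an A a (evN A i)
  | SAdd e1 e2 => (evN A e1 + evN A e2)%N
  | SSub e1 e2 => (evN A e1 - evN A e2)%N
  | SMul e1 e2 => (evN A e1 * evN A e2)%N
  end.

Fixpoint evR (A : astate R) (e : srexp) : R :=
  match e with
  | SOfN k => (evN A k)%:R
  | SR a i => ar A a (evN A i)
  | SRAdd e1 e2 => evR A e1 + evR A e2
  | SRSub e1 e2 => evR A e1 - evR A e2
  | SRMul e1 e2 => evR A e1 * evR A e2
  | SRDiv e1 e2 => evR A e1 / evR A e2
  end.

Fixpoint evB (A : astate R) (b : sbexp) : bool :=
  match b with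
  | SLeN e1 e2 => (evN A e1 <= evN A e2)%N
  | SLeR e1 e2 => evR A e1 <= evR A e2
  | SNot b1 => ~~ evB A b1
  end.

(** Every index read must stay below [n * n], the size of a block: beyond it one would read the next
    array. *)
Fixpoint okN (A : astate R) (e : snexp) : bool :=
  match e with
  | SN a i => okN A i && (evN A i < size)%N
  | SAdd e1 e2 | SSub e1 e2 | SMul e1 e2 => okN A e1 && okN A e2
  | _ => true
  end.

Fixpoint okR (A : astate R) (e : srexp) : bool :=
  match e with
  | SOfN k => okN A k
  | SR a i => okN A i && (evN A i < size)%N
  | SRAdd e1 e2 | SRSub e1 e2 | SRMul e1 e2 | SRDiv e1 e2 =>
      okR A e1 && okR A e2
  end.

Fixpoint okB (A : astate R) (b : sbexp) : bool :=
  match b with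
  | SLeN e1 e2 => okN A e1 && okN A e2
  | SLeR e1 e2 => okR A e1 && okR A e2
  | SNot b1 => okB A b1
  end.

Definition rep (st : state R) (A : astate R) : Prop :=
  [/\ nmem st 0 = n,
      forall a i, (i < size)%N -> nmem st (1 + a * size + i)%N = an A a i &
      forall a i, (i < size)%N -> rmem st (a * size + i)%N = ar A a i].

Lemma block_inj a b i j :
  (i < size)%N -> (j < size)%N -> (a * size + i == b * size + j)%N =
  (a == b) && (i == j).
Proof.
move=> Hi Hj; apply/eqP/andP => [E|[/eqP-> /eqP->]//].
have E1 : a = b.
  by have := congr1 (fun x => x %/ size)%N E; rewrite /= !divnMDl ?muln_gt0 ?n_gt0 // !divn_small // !addn0.
by rewrite E1 eqxx; move: E; rewrite E1 => /eqP; rewrite eqn_add2l => ->.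
Qed.

Lemma evN_comp st A e : rep st A -> okN A e -> neval (nmem st) (compN e) = evN A e.
Proof.
move=> [H0 HN _]; elim: e => //=.
- by move=> a i IH /andP[ok lt]; rewrite H0 IH // HN.
- by move=> e1 IH1 e2 IH2 /andP[/IH1-> /IH2->].
- by move=> e1 IH1 e2 IH2 /andP[/IH1-> /IH2->].
- by move=> e1 IH1 e2 IH2 /andP[/IH1-> /IH2->].
Qed.

Lemma evR_comp st A e : rep st A -> okR A e -> reval st (compR e) = evR A e.
Proof.
move=> rp; have [H0 HN HR] := rp; elim: e => //=.
- by move=> k ok; rewrite (evN_comp rp).
- by move=> a i /andP[ok lt]; rewrite H0 (evN_comp rp) // HR.
- by move=> e1 IH1 e2 IH2 /andP[/IH1-> /IH2->].
- by move=> e1 IH1 e2 IH2 /andP[/IH1-> /IH2->].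
- by move=> e1 IH1 e2 IH2 /andP[/IH1-> /IH2->].
- by move=> e1 IH1 e2 IH2 /andP[/IH1-> /IH2->].
Qed.

Lemma evB_comp st A b : rep st A -> okB A b -> beval st (compB b) = evB A b.
Proof.
move=> rp; elim: b => //=.
- by move=> e1 e2 /andP[o1 o2]; rewrite !(evN_comp rp).
- by move=> e1 e2 /andP[o1 o2]; rewrite !(evR_comp rp).
- by move=> b IH ok; rewrite IH.
Qed.

Lemma rep_setN st A a i v : (i < size)%N -> rep st A ->
  rep (State (upd (nmem st) (1 + a * size + i)%N v) (rmem st)) (setN A a i v).
Proof.
move=> lt [H0 HN HR]; split => //= b j ltj.
rewrite /upd -!addnA !add1n eqSS block_inj //.
have [->|ne] := eqVneq b a; last by rewrite /= upd2_neq // -HN.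
by rewrite upd2_eq /=; case: eqP => // _; rewrite -HN.
Qed.

Lemma rep_setR st A a i v : (i < size)%N -> rep st A ->
  rep (State (nmem st) (upd (rmem st) (a * size + i)%N v)) (setR A a i v).
Proof.
move=> lt [H0 HN HR]; split => //= b j ltj.
rewrite /upd block_inj //.
have [->|ne] := eqVneq b a; last by rewrite /= upd2_neq // -HR.
by rewrite upd2_eq /=; case: eqP => // _; rewrite -HR.
Qed.

(** All oracle calls are made with the one accuracy [e0]; a call of either kind is charged
    [tc + T n e0]. *)
Definition tbound (p : scom) : nat :=
  (tcoef p * n ^ tdeg p + tcalls p * (tc + T n e0))%N.

(** Total correctness in continuation form: the postcondition of the first half of a sequence is the
    judgement on the second half, so proofs proceed by symbolic execution. *)
Definition run (p : scom) (A : astate R) (Q : astate R -> Prop) : Prop :=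
  forall st, rep st A ->
  exists st' t A', [/\ exec (compile p) st st' t, (t <= tbound p)%N,
    rep st' A', frame p A A' & Q A'].

Lemma frame_refl p (A : astate R) : frame p A A.
Proof. by []. Qed.

Lemma frame_trans p (A B C : astate R) : frame p A B -> frame p B C -> frame p A C.
Proof. by move=> [h1 h2] [h3 h4]; split=> a ha; rewrite ?h3 ?h1 ?h4 ?h2. Qed.

Lemma frame_sub p q (A B : astate R) : {subset modN p <= modN q} ->
  {subset modR p <= modR q} -> frame p A B -> frame q A B.
Proof.
move=> sN sR [h1 h2]; split=> a ha.
  by apply: h1; apply: contra ha; apply: sN.
by apply: h2; apply: contra ha; apply: sR.
Qed.

Lemma run_conseq p A (Q Q' : astate R -> Prop) : run p A Q ->
  (forall A', frame p A A' -> Q A' -> Q' A') -> run p A Q'.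
Proof.
move=> h hQ st /h [st' [t [A' [e tl r f q]]]].
by exists st', t, A'; split=> //; exact: hQ.
Qed.

Lemma run_skip A (Q : astate R -> Prop) : Q A -> run SSkip A Q.
Proof.
move=> q st r; exists st, 1%N, A; split=> //; exact: ExecSkip.
Qed.

Lemma run_setN a i v A (Q : astate R -> Prop) :
  okN A i -> (evN A i < size)%N -> okN A v -> Q (setN A a (evN A i) (evN A v)) ->
  run (SSetN a i v) A Q.
Proof.
move=> oi lt ov q st r; have [H0 _ _] := r.
have := ExecStoreN F c tc T opt (addrN a (compN i)) (compN v) st.
rewrite [neval _ (addrN _ _)]/= H0 !(evN_comp r) // => e.
do 3 eexists; split; first exact: e.
- by rewrite /tbound /= expn0 muln1 addn0.
- exact: (rep_setN a (evN A v) lt r).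
- by split=> // b; rewrite /= inE => h; exact: upd2_neq.
- exact: q.
Qed.

Lemma run_setR a i v A (Q : astate R -> Prop) :
  okN A i -> (evN A i < size)%N -> okR A v -> Q (setR A a (evN A i) (evR A v)) ->
  run (SSetR a i v) A Q.
Proof.
move=> oi lt ov q st r; have [H0 _ _] := r.
have := ExecStoreR F c tc T opt (addrR a (compN i)) (compR v) st.
rewrite [neval _ (addrR _ _)]/= H0 (evN_comp r) // (evR_comp r) // => e.
do 3 eexists; split; first exact: e.
- by rewrite /tbound /= expn0 muln1 addn0.
- exact: (rep_setR a (evR A v) lt r).
- by split=> // b; rewrite /= inE => h; exact: upd2_neq.
- exact: q.
Qed.

Lemma pow_mono d d' : (d <= d')%N -> (n ^ d <= n ^ d')%N.
Proof. by move=> ?; rewrite leq_pexp2l. Qed.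

Lemma run_seq p q A (Q : astate R -> Prop) :
  run p A (fun A' => run q A' Q) -> run (SSeq p q) A Q.
Proof.
move=> h st /h [s1 [t1 [A1 [e1 l1 r1 f1]]]] /(_ _ r1) [s2 [t2 [A2 [e2 l2 r2 f2 HQ]]]].
exists s2, (t1 + t2)%N, A2; split=> //=; first exact: ExecSeq e1 e2.
- apply: leq_trans (leq_add l1 l2) _; rewrite /tbound /=.
  rewrite mulnDl mulnDl addnACA leq_add2r.
  by apply: leq_add; rewrite leq_mul2l pow_mono ?orbT ?leq_maxl ?leq_maxr.
- apply: (frame_trans (B := A1)); [apply: frame_sub f1|apply: frame_sub f2];
  by move=> x hx /=; rewrite mem_cat hx ?orbT.
Qed.

Lemma run_if b p q A (Q : astate R -> Prop) : okB A b ->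
  (evB A b -> run p A Q) -> (~~ evB A b -> run q A Q) -> run (SIf b p q) A Q.
Proof.
move=> ok hp hq st r.
have key s : (s = p \/ s = q) -> run s A Q ->
  (if beval st (compB b) then compile p else compile q) = compile s ->
  exists st' t A', [/\ exec (compile (SIf b p q)) st st' t,
    (t <= tbound (SIf b p q))%N, rep st' A', frame (SIf b p q) A A' & Q A'].
  move=> hs /(_ _ r) [st' [t [A' [e tl rr f hQ]]]] E.
  exists st', ((btime (compB b) + t).+1), A'; split=> //.
  - by apply: ExecIf; rewrite E.
  - rewrite -addSn; apply: leq_trans (leq_add (leqnn _) tl) _.
    rewrite /tbound /= mulnDl addnA leq_add //.
      apply: leq_add; first by rewrite leq_pmulr // expn_gt0 n_gt0.
      rewrite leq_mul //; first by case: hs => ->; rewrite ?leq_addr ?leq_addl.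
      by apply: pow_mono; case: hs => ->; rewrite ?leq_maxl ?leq_maxr.
    by rewrite leq_mul2r; apply/orP; right; case: hs => ->; rewrite ?leq_maxl ?leq_maxr.
  - apply: frame_sub f => x hx /=; rewrite mem_cat; case: hs hx => -> ->; by rewrite ?orbT.
have E := evB_comp r ok.
have [eb|eb] := boolP (evB A b).
  by apply: (key p); [left|exact: hp|rewrite E eb].
by apply: (key q); [right|exact: hq|rewrite E (negbTE eb)].
Qed.

(** The body makes no calls, because [tcalls] counts the body of a loop once. The invariant is
    required after the counter has been stored, and the counter is a cell that the body may not
    write. *)
Lemma run_for i p A (Q : astate R -> Prop) (I : nat -> astate R -> Prop) :
  i \notin modN p -> tcalls p = 0%N ->
  I 0%N (setN A i 0 0) ->
  (forall k A', (k < n)%N -> an A' i 0%N = k -> frame (SFor i p) A A' -> I k A' ->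
    run p A' (fun A'' => I k.+1 (setN A'' i 0 k.+1))) ->
  (forall A', frame (SFor i p) A A' -> I n A' -> Q A') ->
  run (SFor i p) A Q.
Proof.
move=> inp tc0 I0 IS IQ st r.
have s_gt0 : (0 < size)%N by rewrite muln_gt0 n_gt0.
pose B := BNot (BLeN dimE (NLoad (scalarE i))).
pose body := CSeq (compile p) (CStoreN (scalarE i) (NAdd (NLoad (scalarE i)) (NConst 1))).
have fset k (A' : astate R) : frame (SFor i p) A A' -> frame (SFor i p) A (setN A' i 0 k).
  move=> f; apply: frame_trans f _; split=> //= b; rewrite in_cons negb_or => /andP[ne _].
  exact: upd2_neq.
have Bt : btime B = 16%N by [].
(* Besides the body, an iteration takes 16 units for the test, 26 for the increment and 1 for the
   loop; the failing test takes 17. The bounds 50 and 20, plus the initial store, fit into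
   [loop_overhead] per iteration since [0 < n]. *)
have loop d : forall k A1 st1, (k + d = n)%N -> an A1 i 0%N = k -> frame (SFor i p) A A1 ->
   I k A1 -> rep st1 A1 -> exists st' t A', [/\ exec (CWhile B body) st1 st' t,
    (t <= 20 + d * (tcoef p * n ^ tdeg p + 50))%N, rep st' A', frame (SFor i p) A A' & Q A'].
  elim: d => [|d IH] k A1 st1 kd ik f Ik r1.
    have [H0 HN _] := r1.
    exists st1, 17%N, A1; split=> //; last by apply: IQ => //; rewrite -kd addn0.
    rewrite -Bt; apply: ExecWhileStop.
    by rewrite /= H0 HN // ik -kd addn0 leqnn.
  have kn : (k < n)%N by rewrite -kd addnS ltnS leq_addr.
  have [s2 [t2 [A2 [e2 l2 r2 f2 I2]]]] := IS k A1 kn ik f Ik _ r1.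
  have ik2 : an A2 i 0%N = k by rewrite (proj1 f2) // ik.
  have [H02 HN2 _] := r2.
  have [s3 [t3 [A3 [e3 l3 r3 f3 q3]]]] := IH k.+1 (setN A2 i 0 k.+1)
    (State (upd (nmem s2) (1 + i * size + 0)%N k.+1) (rmem s2))
    ltac:(by rewrite addSnnS) ltac:(by rewrite /= upd2_eq) 
    (fset _ _ (frame_trans f (frame_sub (fun x hx => mem_behead (s := modN (SFor i p)) hx) (fun x hx => hx) f2)))
    I2 (rep_setN _ _ s_gt0 r2).
  have es := ExecStoreN F c tc T opt (scalarE i) (NAdd (NLoad (scalarE i)) (NConst 1)) s2.
  move: es; rewrite [neval _ (NAdd _ _)]/= [neval _ (scalarE i)]/= H02 HN2 // ik2 addn1 => es.
  have [H0 HN _] := r1.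
  do 3 eexists; split; [apply: ExecWhileStep e3|..]; last exact: q3; [| |  |exact: r3|exact: f3].
  - by rewrite /= H0 HN // ik -ltnNge.
  - exact: ExecSeq e2 es.
  - move: l2 l3; rewrite /tbound tc0 Bt mul0n addn0 /= mulSn => l2 l3.
    by move: l2 l3; set X := (tcoef p * _)%N; set Y := (d * _)%N; move=> *; lia.
have e0' := ExecStoreN F c tc T opt (scalarE i) (NConst 0) st.
have [H0 HN _] := r.
move: e0'; rewrite [neval _ (scalarE i)]/= H0 => e0'.
have [s3 [t3 [A3 [e3 l3 r3 f3 q3]]]] := loop n 0%N (setN A i 0 0) _ (erefl _)
  ltac:(by rewrite /= upd2_eq) (fset _ _ (frame_refl _ _)) I0 (rep_setN i 0 s_gt0 r).
do 3 eexists; split; [apply: ExecSeq e0' e3| |exact: r3|exact: f3|exact: q3].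
move: l3; rewrite /tbound /= tc0 mul0n addn0 expnS mulnDl.
have : (n <= n * n ^ tdeg p)%N by rewrite leq_pmulr // expn_gt0 n_gt0.
rewrite mulnDr mulnCA /loop_overhead.
set X := (tcoef p * (n * n ^ _))%N; set Y := (n * n ^ _)%N => h1 h2.
by move: n_gt0 h1 h2 => *; lia.
Qed.

Definition aset (A : astate R) (a i : nat) : {set 'I_n} :=
  [set k : 'I_n | an A a (i + k)%N != 0%N].

Definition setS (A : astate R) (a : nat) (S : {set 'I_n}) : astate R :=
  AState (fun b => if Nat.eqb b a then
            (fun k => if (k < n)%N then nat_of_bool [exists i in S, k == i :> nat]
                      else an A b k) else an A b) (ar A).

Lemma ltn_size i : (i < n)%N -> (i < size)%N.
Proof. by move=> h; apply: leq_trans h _; rewrite leq_pmulr. Qed.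

Lemma ltn_size2 i j : (i < n)%N -> (j < n)%N -> (i * n + j < size)%N.
Proof.
move=> hi hj; apply: (@leq_trans (i.+1 * n)%N); first by rewrite mulSn addnC ltn_add2r.
by rewrite leq_mul2r hi orbT.
Qed.

Lemma read_setE st A a i : rep st A -> (i + n <= size)%N ->
  read_set n (nmem st) (1 + a * size + i)%N = aset A a i.
Proof.
move=> [_ HN _] h; apply/setP => k; rewrite !inE -addnA HN //.
by apply: leq_trans h; rewrite ltn_add2l.
Qed.

Lemma run_cost s a A (Q : astate R -> Prop) :
  aset A s 0 \in F -> Q (setR A a 0 (c (aset A s 0))) -> run (SCost s a) A Q.
Proof.
move=> SF q st r; have [H0 _ _] := r.
have hn : (0 + n <= size)%N by rewrite add0n leq_pmulr.
have := @ExecCost R n F c tc T opt (scalarE s) (addrR a (NConst 0)) st.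
rewrite [neval _ (scalarE s)]/= [neval _ (addrR _ _)]/= H0 (read_setE s r hn) => /(_ SF) e.
do 3 eexists; split; first exact: e.
- rewrite /tbound /= expn0 muln1 mul1n; lia.
- have s0 : (0 < size)%N by rewrite muln_gt0 n_gt0.
  exact: (rep_setR a _ s0 r).
- by split=> // b; rewrite /= inE => h; exact: upd2_neq.
- exact: q.
Qed.

Lemma run_opt y e s A (v : 'rV[rat]_n) (Q : astate R -> Prop) :
  (forall i : 'I_n, ar A y i = ratr (v 0 i)) -> (forall i, 0 <= v 0 i) ->
  okR A e -> evR A e = e0 -> 0 < e0 -> Q (setS A s (opt v e0)) ->
  run (SOpt y e s) A Q.
Proof.
move=> hv v0 ok ee e0p q st r; have [H0 HN HR] := r.
have := @ExecOpt R n F c tc T opt (addrR y (NConst 0)) (compR e) (scalarE s) st v.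
rewrite (evR_comp r ok) ee [neval _ (scalarE s)]/= [neval _ (addrR _ _)]/= H0 !addn0.
have hv' (i : 'I_n) : rmem st (y * size + i)%N = ratr (v 0 i).
  by rewrite HR // ltn_size.
move=> /(_ hv' v0 e0p) ex.
do 2 eexists; exists (setS A s (opt v e0)); split; first exact: ex.
- rewrite /tbound [tcoef _]/= [tdeg _]/= [tcalls _]/= expn0 muln1 mul1n.
  by rewrite addSn ltnS leq_add2l leq_addl.
- split; [by rewrite /= /write_set add1n| |exact: HR].
  move=> a i hi; rewrite /= /write_set -addnA.
  have [/andP[h1 h2]|] := boolP (_ && _).
    have [ea li] : a = s /\ (i < n)%N.
      have hs : (a * size + i = s * size + (a * size + i - s * size))%N by lia.
      have /eqP := hs; rewrite block_inj //; first by case/andP=> /eqP ea _; subst a; split=> //; lia.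
      have : (n <= size)%N by rewrite leq_pmulr.
      by lia.
    rewrite ea PeanoNat.Nat.eqb_refl li; congr nat_of_bool.
    by apply: eq_existsb => k; rewrite -addnA !eqn_add2l.
  rewrite negb_and => h; case: PeanoNat.Nat.eqb_spec => [ea|_]; last by rewrite addnA HN.
  case: ifP => li; last by rewrite addnA HN.
  by exfalso; move: h; rewrite ea; lia.
- by split=> // b; rewrite /= inE; case: PeanoNat.Nat.eqb_spec => // -> /eqP.
- exact: q.
Qed.

(** The measure bounds the number of rounds; the extra unit in [(mu A).+1] pays for the final,
    failing test. *)
Lemma run_while b p A (I : astate R -> Prop) (mu : astate R -> nat) st :
  (forall A', I A' -> okB A' b) ->
  (forall A', I A' -> evB A' b -> run p A' (fun A'' => I A'' /\ (mu A'' < mu A')%N)) ->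
  I A -> rep st A ->
  exists st' t A', [/\ exec (CWhile (compB b) (compile p)) st st' t,
    (t <= (mu A).+1 * (tbound p + (btime (compB b)).+1))%N, rep st' A', I A' & ~~ evB A' b].
Proof.
move=> ok step; move: {2}(mu A) (leqnn (mu A)) => d.
elim: d A st => [|d IH] A st md IA r; have okA := ok _ IA;
  have [eb|eb] := boolP (evB A b).
- by have [? [? [? [_ _ _ _ [_]]]]] := step _ IA eb _ r; lia.
- exists st, (btime (compB b)).+1, A; split=> //.
    by apply: ExecWhileStop; rewrite (evB_comp r).
  by rewrite mulSn; lia.
- have [s1 [t1 [A1 [e1 l1 r1 _ [I1 m1]]]]] := step _ IA eb _ r.
  have [|s2 [t2 [A2 [e2 l2 r2 I2 nb]]]] := IH A1 s1 _ I1 r1; first lia.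
  do 3 eexists; split; [apply: ExecWhileStep e1 e2| |exact: r2|exact: I2|exact: nb].
    by rewrite (evB_comp r).
  move: l1 l2; set X := tbound p; set Y := btime _ => l1 l2.
  have : ((mu A1).+2 * (X + Y.+1) <= (mu A).+1 * (X + Y.+1))%N by rewrite leq_mul2r; lia.
  by rewrite mulSn; lia.
- exists st, (btime (compB b)).+1, A; split=> //.
    by apply: ExecWhileStop; rewrite (evB_comp r).
  by rewrite mulSn; lia.
Qed.

End Run.

Arguments upd2 {V} m a i v b /.

(** * Absorbing a column into a basis *)

(* Arrays of natural numbers: [vsets] the sets of the basis (row [l] is the set
   of column [l]), [vS] the current set, [vm] the covering counts, [vact] the
   number of elements covered less than [vM] times, [vp] the pivot row. *)
Notation vsets := 0%N (only parsing).
Notation vS := 1%N (only parsing).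
Notation vm := 2%N (only parsing).
Notation vN := 3%N (only parsing).
Notation vL := 4%N (only parsing).
Notation vM := 5%N (only parsing).
Notation vact := 6%N (only parsing).
Notation vstep := 7%N (only parsing).
Notation vi := 8%N (only parsing).
Notation vj := 9%N (only parsing).
Notation vl := 10%N (only parsing).
Notation vp := 11%N (only parsing).

(* Arrays of reals: [xz] the coefficients of the basic columns, [xcost] their
   costs, [xB] the inverse of the basis matrix, [xy] the weights; [xa], [xca] and
   [xalpha] the entering column, its cost and its coefficient, [xu] its
   coordinates in the basis.  A basic column is a slack [- e_i] exactly when its
   cost is [0]; the entry of [vsets] is then an irrelevant set of the family. *)
Notation xz := 0%N (only parsing).
Notation xy := 1%N (only parsing).
Notation xcost := 2%N (only parsing).
Notation xu := 3%N (only parsing).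
Notation xa := 4%N (only parsing).
Notation xB := 5%N (only parsing).
Notation xr := 6%N (only parsing).
Notation xdelta := 7%N (only parsing).
Notation xca := 8%N (only parsing).
Notation xalpha := 9%N (only parsing).
Notation xred := 10%N (only parsing).
Notation xsg := 11%N (only parsing).
Notation xth := 12%N (only parsing).
Notation xcz := 13%N (only parsing).
Notation xup := 14%N (only parsing).

Notation nv a := (SN a (SC 0)).
Notation rv a := (SR a (SC 0)).
Notation "a :=n e" := (SSetN a (SC 0) e) (at level 90).
Notation "a :=r e" := (SSetR a (SC 0) e) (at level 90).
Notation "p ;; q" := (SSeq p q) (at level 95, right associativity).
Notation entry i j := (SAdd (SMul (nv i) SDim) (nv j)).
Notation zeroE := (SOfN (SC 0)).
Notation oneE := (SOfN (SC 1)).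

(** [xu] is the inverse basis applied to the entering column, [xred] its reduced cost, and [xcz] the
    cost of the solution with the entering column taken [xalpha] times. *)
Definition price : scom :=
  xred :=r rv xca ;;
  xcz :=r SRMul (rv xalpha) (rv xca) ;;
  SFor vl (
    SSetR xu (nv vl) zeroE ;;
    SFor vj (SSetR xu (nv vl) (SRAdd (SR xu (nv vl))
              (SRMul (SR xB (entry vl vj)) (SR xa (nv vj))))) ;;
    xred :=r SRSub (rv xred) (SRMul (SR xcost (nv vl)) (SR xu (nv vl))) ;;
    xcz :=r SRAdd (rv xcz) (SRMul (SR xcost (nv vl)) (SR xz (nv vl)))).

(* [xsg] is [1] if the entering column is to be moved into the basis, and [-1] if
   it should be increased because its reduced cost is negative.  The initial
   [xth] is then out of reach: it would make the cost of the solution negative. *)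
Definition ratio_test : scom :=
  vp :=n SDim ;;
  SIf (SLeR zeroE (rv xred))
    (xsg :=r oneE ;; xth :=r rv xalpha)
    (xsg :=r SRSub zeroE oneE ;;
     xth :=r SRAdd (SRDiv (rv xcz) (SRSub zeroE (rv xred))) oneE) ;;
  SFor vl
    (SIf (SLeR zeroE (SRAdd (SR xz (nv vl))
                   (SRMul (rv xth) (SRMul (rv xsg) (SR xu (nv vl))))))
      SSkip
      (vp :=n nv vl ;;
       xth :=r SRDiv (SRSub zeroE (SR xz (nv vl))) (SRMul (rv xsg) (SR xu (nv vl))))).

Definition move_basic : scom :=
  SFor vl (SSetR xz (nv vl) (SRAdd (SR xz (nv vl))
             (SRMul (rv xth) (SRMul (rv xsg) (SR xu (nv vl)))))).

(** The inverse changes by the rank-one matrix [(u - e_p) * (row p / u_p)]. Subtracting 1 from [u_p]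
    beforehand makes the formula the same for all rows, including the pivot row; [xr] keeps the
    scaled pivot row, which the double loop overwrites in [xB]. The entering column keeps the part
    of its coefficient that was not moved. *)
Definition exchange : scom :=
  SSetR xz (nv vp) (SRSub (rv xalpha) (SRMul (rv xsg) (rv xth))) ;;
  SSetR xcost (nv vp) (rv xca) ;;
  xup :=r SR xu (nv vp) ;;
  SFor vj (SSetR xr (nv vj) (SRDiv (SR xB (entry vp vj)) (rv xup))) ;;
  SSetR xu (nv vp) (SRSub (SR xu (nv vp)) oneE) ;;
  SFor vl (SFor vj (SSetR xB (entry vl vj) (SRSub (SR xB (entry vl vj))
                     (SRMul (SR xu (nv vl)) (SR xr (nv vj)))))) ;;
  SIf (SLeR (rv xca) zeroE) SSkip
    (SFor vj (SSetN vsets (entry vp vj) (SN vS (nv vj)))).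

Definition absorb : scom :=
  price ;; ratio_test ;; move_basic ;; SIf (SLeN SDim (nv vp)) SSkip exchange.

Lemma size_gt0 n : (0 < n)%N -> (0 < n * n)%N.
Proof. by rewrite muln_gt0 => ->. Qed.

Lemma updE (V : Type) (m : nat -> V) a v k :
  upd m a v k = if k == a then v else m k.
Proof. by []. Qed.

Ltac counters := repeat match goal with
  | H : an _ _ 0%N = _ |- _ => rewrite H end.
Ltac side := rewrite /=; counters; do ?[apply/andP; split];
  first [exact: isT|by apply: size_gt0|by apply: ltn_size2|by apply: ltn_size].
Ltac store := first [apply: run_setR; [assumption|side|side|side|]
                    |apply: run_setN; [assumption|side|side|side|]]; rewrite /=.
Ltac loop I := match goal with H : is_true (0 < _)%N |- _ =>
  apply (@run_for _ _ _ _ _ _ _ _ H _ _ _ _ I) end.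
Ltac seq := apply: run_seq; first assumption.
Ltac branch := apply: run_if; [assumption|side| |]; rewrite /=.

(** * Correctness of the pivot *)

Section Absorb.

Variables (R : realType) (n : nat) (F : {set {set 'I_n}}).
Variables (c : {set 'I_n} -> R) (tc : nat) (T : nat -> R -> nat).
Variables (opt : 'rV[rat]_n -> R -> {set 'I_n}) (e0 : R).
Hypothesis n_gt0 : (0 < n)%N.

Notation run := (run F c tc T opt e0).

Lemma price_spec (A : astate R) :
  let u l := \sum_(j < n) ar A xB (l * n + j)%N * ar A xa j in
  run price A (fun A' => [/\ forall l, (l < n)%N -> ar A' xu l = u l,
    ar A' xred 0%N = ar A xca 0%N - \sum_(l < n) ar A xcost l * u l &
    ar A' xcz 0%N = ar A xalpha 0%N * ar A xca 0%N +
      \sum_(l < n) ar A xcost l * ar A xz l]).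
Proof.
move=> u; seq; store; seq; store.
set A0 := setR (setR _ _ _ _) _ _ _.
loop (fun k A' => [/\ forall l, (l < k)%N -> ar A' xu l = u l,
    ar A' xred 0%N = ar A xca 0%N - \sum_(l < k) ar A xcost l * u l &
    ar A' xcz 0%N = ar A xalpha 0%N * ar A xca 0%N +
      \sum_(l < k) ar A xcost l * ar A xz l]) => //.
- by split=> //=; rewrite big_ord0 ?subr0 ?addr0.
- move=> k A1 kn ik f [Iu Ir Iz].
  have eB := proj2 f xB isT; have ea := proj2 f xa isT.
  have ec := proj2 f xcost isT; have ez := proj2 f xz isT.
  seq; store; seq.
  set A2 := setR _ _ _ _.
  have ik2 : an A2 vl 0%N = k by [].
  loop (fun k' A' => (forall l, l != k -> ar A' xu l = ar A1 xu l) /\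
    ar A' xu k = \sum_(j < k') ar A xB (k * n + j)%N * ar A xa j) => //.
  + by split=> [l ne|]; rewrite /A2 /= ik updE ?(negbTE ne) // eqxx big_ord0.
  + move=> k' A3 kn' ik' f' [I1 I2].
    have ik3 : an A3 vl 0%N = k by rewrite (proj1 f' vl isT).
    store; rewrite ik3 ik'; split=> [l ne|]; rewrite updE.
      by rewrite (negbTE ne) I1.
    rewrite eqxx big_ord_recr /= I2.
    by rewrite (proj2 f' xB isT) (proj2 f' xa isT) /= eB ea.
  + move=> A3 f' [I1 I2].
    have ik3 : an A3 vl 0%N = k by rewrite (proj1 f' vl isT).
    seq; store; store; rewrite ik3.
    split.
    * move=> l; rewrite ltnS leq_eqVlt => /orP[/eqP->//|lk].
      by rewrite I1 ?Iu // ltn_eqF.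
    * rewrite I2 (proj2 f' xred isT) (proj2 f' xcost isT) /= Ir ec /=.
      by rewrite big_ord_recr /= opprD addrA.
    * rewrite (proj2 f' xcz isT) (proj2 f' xcost isT) (proj2 f' xz isT) /= Iz ec ez /=.
      by rewrite big_ord_recr /= addrA.
Qed.

(** The minimum of the ratios is found by lowering [xth] whenever a row would become negative. Rows
    already passed stay nonnegative: at a smaller [xth] their value lies between [z l >= 0] and the
    former value. *)
Lemma ratio_test_spec (A : astate R) :
  let z := ar A xz in let u := ar A xu in
  let red := ar A xred 0%N in
  (forall l, (l < n)%N -> 0 <= z l) -> 0 <= ar A xalpha 0%N -> 0 <= ar A xcz 0%N ->
  run ratio_test A (fun A' =>
    let th := ar A' xth 0%N in let sg := ar A' xsg 0%N in
    let th0 := if 0 <= red then ar A xalpha 0%N else ar A xcz 0%N / - red + 1 in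
    [/\ sg = (if 0 <= red then 1 else -1), 0 <= th <= th0,
       forall l, (l < n)%N -> 0 <= z l + th * (sg * u l) &
       (an A' vp 0%N = n /\ th = th0) \/
       ((an A' vp 0%N < n)%N /\ let p := an A' vp 0%N in
         u p != 0 /\ z p + th * (sg * u p) = 0)]).
Proof.
move=> z u red z0 a0 cz0; seq; store; seq.
set th0 := (if 0 <= red then ar A xalpha 0%N else _).
set sg0 : R := if 0 <= red then 1 else -1.
have th00 : 0 <= th0.
  rewrite /th0; case: ifP => // /negbT; rewrite -ltNge => h.
  by rewrite addr_ge0 // divr_ge0 // oppr_ge0 ltW.
pose A1 := setN A vp 0 n.
have key A' : (forall b, an A' b = an A1 b) -> ar A' xz = z -> ar A' xu = u ->
    ar A' xsg 0%N = sg0 -> ar A' xth 0%N = th0 ->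
  run (SFor vl
    (SIf (SLeR zeroE (SRAdd (SR xz (nv vl))
                   (SRMul (rv xth) (SRMul (rv xsg) (SR xu (nv vl))))))
      SSkip
      (vp :=n nv vl ;;
       xth :=r SRDiv (SRSub zeroE (SR xz (nv vl))) (SRMul (rv xsg) (SR xu (nv vl)))))) A'
  (fun A' =>
    let th := ar A' xth 0%N in let sg := ar A' xsg 0%N in
    [/\ sg = sg0, 0 <= th <= th0,
       forall l, (l < n)%N -> 0 <= z l + th * (sg * u l) &
       (an A' vp 0%N = n /\ th = th0) \/
       ((an A' vp 0%N < n)%N /\ let p := an A' vp 0%N in
         u p != 0 /\ z p + th * (sg * u p) = 0)]).
  move=> eN ez eu es et.
  loop (fun k A' =>
     let th := ar A' xth 0%N in 
    [/\ 0 <= th <= th0,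
       forall l, (l < k)%N -> 0 <= z l + th * (sg0 * u l) &
       (an A' vp 0%N = n /\ th = th0) \/
       ((an A' vp 0%N < n)%N /\ let p := an A' vp 0%N in
         u p != 0 /\ z p + th * (sg0 * u p) = 0)]) => //.
  - by rewrite /= et; split; rewrite ?th00 ?lexx //; left; rewrite eN /=.
  - move=> k A2 kn ik f [/andP[t0 tt] Il Ip].
    have ez2 : ar A2 xz = z by rewrite (proj2 f xz isT).
    have eu2 : ar A2 xu = u by rewrite (proj2 f xu isT).
    have es2 : ar A2 xsg 0%N = sg0 by rewrite (proj2 f xsg isT).
    branch.
      rewrite /= ik ez2 eu2 es2 => h; apply: run_skip; rewrite /=; split=> //.
        by rewrite t0.
      by move=> l; rewrite ltnS leq_eqVlt => /orP[/eqP->//|/Il].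
    rewrite /= ik ez2 eu2 es2 -ltNge => h; seq; store; store.
    rewrite ik ez2 eu2 es2 /=.
    set w := sg0 * u k in h *; set th := ar A2 xth 0%N in t0 tt Il Ip h.
    have zk : 0 <= z k by exact: z0.
    have w0 : w < 0.
      rewrite ltNge; apply/negP => w0.
      have : 0 <= th * w by rewrite mulr_ge0.
      lra.
    have w1 : w != 0 by rewrite lt_eqF.
    have th1 : (0%:R - z k) / w * w = - z k by rewrite divfK // sub0r.
    set th' := (0%:R - z k) / w in th1 *.
    have lt : th' < th.
      rewrite -(ltr_nM2r w0) th1; lra.
    have ge : 0 <= th' by rewrite -(ler_nM2r w0) th1 mul0r oppr_le0.
    split.
    + by rewrite ge (le_trans (ltW lt)).
    + move=> l; rewrite ltnS leq_eqVlt => /orP[/eqP->|lk].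
        by rewrite -/w th1 subrr.
      have := Il _ lk; have := z0 _ (ltn_trans lk kn).
      set v := sg0 * u l => h1 h2.
      have [v0|v0] := lerP 0 v; first by rewrite addr_ge0 // mulr_ge0.
      by apply: le_trans h2 _; rewrite lerD2l ler_nM2r // ltW.
    + right; split=> //; rewrite -/w th1 subrr; split=> //.
      by apply: contraNneq w1; rewrite /w => ->; rewrite mulr0.
  - move=> A2 f [I1 I2 I3]; rewrite /=.
    have es2 : ar A2 xsg 0%N = sg0 by rewrite (proj2 f xsg isT).
    by rewrite es2.
branch => h; seq; store; store.
- by apply: key => //=; rewrite /sg0 /th0 /red h.
- apply: key => //=; rewrite /sg0 /th0 /red (negbTE h) ?sub0r //.
Qed.

Lemma move_basic_spec (A : astate R) :
  run move_basic A (fun A' => forall l, (l < n)%N ->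
    ar A' xz l = ar A xz l + ar A xth 0%N * (ar A xsg 0%N * ar A xu l)).
Proof.
loop (fun k A' => forall l, ar A' xz l = ar A xz l +
  (if (l < k)%N then ar A xth 0%N * (ar A xsg 0%N * ar A xu l) else 0)) => //.
- by move=> l; rewrite /= addr0.
- move=> k A1 kn ik f Iz; store; rewrite ik => l.
  rewrite updE ltnS (proj2 f xth isT) (proj2 f xsg isT) (proj2 f xu isT) /=.
  case: eqP => [->|/eqP ne]; rewrite Iz; first by rewrite ltnn leqnn addr0.
  by rewrite ltn_neqAle ne.
- by move=> A1 _ Iz l ln; rewrite Iz ln.
Qed.

Lemma entry_eq (i i' j j' : nat) : (j < n)%N -> (j' < n)%N ->
  (i * n + j == i' * n + j')%N = (i == i') && (j == j').
Proof.
move=> hj hj'; apply/eqP/andP => [E|[/eqP-> /eqP->]//].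
have E1 : i = i'.
  by have := congr1 (fun x => x %/ n)%N E; rewrite /= !divnMDl // !divn_small // !addn0.
by rewrite E1 eqxx; move: E; rewrite E1 => /eqP; rewrite eqn_add2l => ->.
Qed.

Lemma exchange_spec (A : astate R) (p := an A vp 0%N) :
  (p < n)%N ->
  run exchange A (fun A' =>
  [/\ forall l, ar A' xz l =
        if l == p then ar A xalpha 0%N - ar A xsg 0%N * ar A xth 0%N else ar A xz l,
      forall l, ar A' xcost l = if l == p then ar A xca 0%N else ar A xcost l,
      forall i j, (i < n)%N -> (j < n)%N -> ar A' xB (i * n + j)%N =
        ar A xB (i * n + j)%N -
        (ar A xu i - (i == p)%:R) * (ar A xB (p * n + j)%N / ar A xu p) &
      forall l, (l < n)%N -> aset n A' vsets (l * n) =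
        if (l == p) && (0 < ar A xca 0%N) then aset n A vS 0 else aset n A vsets (l * n)]).
Proof.
move=> pn; have ip : an A vp 0%N = p by [].
seq; store; seq; store; seq; store; rewrite ip; seq.
set A1 := setR _ xup _ _.
loop (fun k A' => forall j, (j < k)%N ->
  ar A' xr j = ar A xB (p * n + j)%N / ar A xu p) => //.
  move=> k A2 kn ik f Ir; have ip2 : an A2 vp 0%N = p by rewrite (proj1 f vp isT).
  store; rewrite ik ip2 => j; rewrite updE (proj2 f xB isT) (proj2 f xup isT) /= => jk.
  case: eqP => [->//|ne]; apply: Ir.
  by rewrite ltn_neqAle -ltnS jk andbT; apply/eqP.
move=> A2 f2 Ir; have ip2 : an A2 vp 0%N = p by rewrite (proj1 f2 vp isT).
have eu2 : ar A2 xu = ar A xu by rewrite (proj2 f2 xu isT).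
have eB2 : ar A2 xB = ar A xB by rewrite (proj2 f2 xB isT).
seq; store; rewrite ip2 eu2; seq.
set A3 := setR _ xu _ _.
loop (fun k A' => forall i j, (i < n)%N -> (j < n)%N -> ar A' xB (i * n + j)%N =
  ar A xB (i * n + j)%N - if (i < k)%N then
        (ar A xu i - (i == p)%:R) * (ar A xB (p * n + j)%N / ar A xu p) else 0) => //.
- by move=> i j _ _; rewrite /= eB2 subr0.
- move=> k A4 kn ik f IB.
  loop (fun k' A' => forall i j, (i < n)%N -> (j < n)%N -> ar A' xB (i * n + j)%N =
    ar A xB (i * n + j)%N - if (i < k)%N || ((i == k) && (j < k')%N) then
        (ar A xu i - (i == p)%:R) * (ar A xB (p * n + j)%N / ar A xu p) else 0) => //.
  + by move=> i j hi hj; rewrite /= IB // andbF orbF.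
  + move=> k' A5 kn' ik' f' IB'.
    have ik5 : an A5 vl 0%N = k by rewrite (proj1 f' vl isT).
    store; rewrite ik5 ik' => i j hi hj.
    rewrite updE entry_eq // (proj2 f' xu isT) (proj2 f' xr isT) /=.
    rewrite (proj2 f xu isT) (proj2 f xr isT) /= Ir // updE.
    case: ifP => [/andP[/eqP-> /eqP->]|ne].
      rewrite IB' // ltnn eqxx /= ltnn leqnn subr0; congr (_ - _ * _).
      by case: eqP => [->|_] //; rewrite subr0 eu2.
    rewrite IB' //.
    suff -> : (i == k) && (j < k'.+1)%N = (i == k) && (j < k')%N by [].
    by move: ne; case: (i == k) => //= ne; rewrite ltnS leq_eqVlt ne.
  + move=> A5 f' IB' i j hi hj; rewrite /= IB' // hj andbT ltnS.
    by rewrite (leq_eqVlt i) orbC.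
move=> A4 f4 IB.
have eS : an A4 vS = an A vS by rewrite (proj1 f4 vS isT) /= (proj1 f2 vS isT).
have es : an A4 vsets = an A vsets by rewrite (proj1 f4 vsets isT) /= (proj1 f2 vsets isT).
have ez : ar A4 xz = upd (ar A xz) p (ar A xalpha 0%N - ar A xsg 0%N * ar A xth 0%N).
  by rewrite (proj2 f4 xz isT) /= (proj2 f2 xz isT).
have ec : ar A4 xcost = upd (ar A xcost) p (ar A xca 0%N).
  by rewrite (proj2 f4 xcost isT) /= (proj2 f2 xcost isT).
have eca : ar A4 xca = ar A xca.
  by rewrite (proj2 f4 xca isT) /= (proj2 f2 xca isT).
have ip4 : an A4 vp 0%N = p by rewrite (proj1 f4 vp isT) /=.
have IB4 i j : (i < n)%N -> (j < n)%N -> ar A4 xB (i * n + j)%N =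
        ar A xB (i * n + j)%N -
        (ar A xu i - (i == p)%:R) * (ar A xB (p * n + j)%N / ar A xu p).
  by move=> hi hj; rewrite IB // hi.
branch; rewrite eca => h.
  apply: run_skip; split=> //; rewrite ?ez ?ec //.
  by move=> l ln; rewrite ltNge h andbF /aset es.
loop (fun k (A' : astate R) => forall i j, (i < n)%N -> (j < n)%N -> an A' vsets (i * n + j)%N =
  if (i == p) && (j < k)%N then an A vS j else an A vsets (i * n + j)%N) => //.
- by move=> i j hi hj; rewrite /= es andbF.
- move=> k A5 kn ik f IS.
  have ip5 : an A5 vp 0%N = p by rewrite (proj1 f vp isT).
  store; rewrite ik ip5 => i j hi hj; rewrite updE entry_eq //.
  rewrite (proj1 f vS isT) /= eS.
  case: ifP => [/andP[/eqP-> /eqP->]|ne]; first by rewrite eqxx ltnS leqnn.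
  rewrite IS //.
  suff -> : (i == p) && (j < k.+1)%N = (i == p) && (j < k)%N by [].
  by move: ne; case: (i == p) => //= ne; rewrite ltnS leq_eqVlt ne.
- move=> A5 f IS; split.
  + by move=> l; rewrite (proj2 f xz isT) ez.
  + by move=> l; rewrite (proj2 f xcost isT) ec.
  + by move=> i j hi hj; rewrite (proj2 f xB isT) IB4.
  + move=> l ln; rewrite ltNge h andbT; apply/setP => k.
    rewrite inE IS // ltn_ord andbT.
    by case: ifP => _; rewrite inE.
Qed.

Definition binv (A : astate R) : 'M[R]_n := \matrix_(i, j) ar A xB (i * n + j)%N.
Definition cvec (A : astate R) (b : nat) : 'cV[R]_n := \col_i ar A b i.

(** Sets have positive cost, so cost [0] identifies slacks. Membership in [F] is demanded of slacks
    as well, since every entry of the output must name a set of the family. *)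
Definition column (S : {set 'I_n}) (w : R) (a : 'cV[R]_n) : Prop :=
  S \in F /\
  ([/\ 0 < w, w = c S & a = \col_i (i \in S)%:R] \/
   (w = 0 /\ exists i, a = - delta_mx i 0)).

(** Memory holds only the inverse of the basis matrix; the matrix itself is existential. [C] is an
    upper bound, so that a pivot that lowers the cost needs no bookkeeping. *)
Definition basis (A : astate R) (b : 'cV[R]_n) (C : R) : Prop :=
  exists B : 'M[R]_n,
  [/\ binv A *m B = 1%:M,
      forall l : 'I_n, column (aset n A vsets (l * n)) (ar A xcost l) (col l B),
      forall l : 'I_n, 0 <= ar A xz l,
      B *m cvec A xz = b &
      \sum_(l < n) ar A xcost l * ar A xz l <= C].

Lemma column_cost_ge0 S w a : column S w a -> 0 <= w.
Proof. by move=> [_ [[/ltW]|[-> _]]]. Qed.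

Lemma sum_replace (p : 'I_n) (f : 'I_n -> R) (x : R) :
  \sum_j (if j == p then x else f j) = \sum_j f j - f p + x.
Proof.
rewrite (bigD1 p) //= eqxx [in RHS](bigD1 p) //=.
have -> : \sum_(j < n | j != p) (if j == p then x else f j) = \sum_(j < n | j != p) f j.
  by apply: eq_bigr => j /negbTE ->.
by ring.
Qed.

(** [Bi *m B'] is the identity with column [p] replaced by [u], and passing from [Bi] to [Bi'] is
    the row operation that turns this column into a unit vector. *)
Lemma exchange_inverse (Bi Bi' B B' : 'M[R]_n) (a u : 'cV[R]_n) (p : 'I_n) :
  u = Bi *m a ->
  Bi *m B = 1%:M -> u p 0 != 0 ->
  (forall i j, Bi' i j = Bi i j - (u i 0 - (i == p)%:R) * (Bi p j / u p 0)) ->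
  (forall i j, B' i j = if j == p then a i 0 else B i j) ->
  Bi' *m B' = 1%:M.
Proof.
move=> eu BB up eBi eB; apply/matrixP => i j.
have key k : (Bi *m B') k j = if j == p then u k 0 else (k == j)%:R.
  have [->|ne] := eqVneq j p.
    by rewrite eu !mxE; apply: eq_bigr => l _; rewrite eB eqxx.
  have := congr1 (fun M : 'M_n => M k j) BB; rewrite [in RHS]mxE => <-.
  by rewrite !mxE; apply: eq_bigr => l _; rewrite eB (negbTE ne).
have -> : (Bi' *m B') i j =
    (Bi *m B') i j - (u i 0 - (i == p)%:R) / u p 0 * (Bi *m B') p j.
  rewrite !mxE mulr_sumr -sumrB; apply: eq_bigr => l _.
  by rewrite eBi; ring.
rewrite !key mxE; have [->|ne] := eqVneq j p.
  by rewrite divfK // opprB addrC subrK.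
by rewrite mulr0 subr0.
Qed.

(** Since [B *m u = a], replacing [z] by [z + th * sg * u] and the coefficient [alpha] by
    [alpha - sg * th] keeps the total at [b + alpha * a] and changes the cost by
    [- th * (sg * red) <= 0]. The move ends when the entering column is used up, which needs no
    exchange, or when a basic coefficient reaches [0], and then the entering column takes its
    place. *)
Lemma absorb_spec (A : astate R) b C : basis A b C ->
  column (aset n A vS 0) (ar A xca 0%N) (cvec A xa) ->
  0 <= ar A xalpha 0%N ->
  run absorb A (fun A' => basis A' (b + ar A xalpha 0%N *: cvec A xa)
                                (C + ar A xalpha 0%N * ar A xca 0%N)).
Proof.
move=> [B [BB Bc z0 Bz Cz]] ac al0.
set alpha := ar A xalpha 0%N; set ca := ar A xca 0%N; set a := cvec A xa.
have ca0 : 0 <= ca := column_cost_ge0 ac.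
pose cost (l : nat) := ar A xcost l.
pose z (l : nat) := ar A xz l.
have cost0 (l : 'I_n) : 0 <= cost l := column_cost_ge0 (Bc l).
pose u := binv A *m a.
pose zz := \sum_(l < n) cost l * z l.
pose cu := \sum_(l < n) cost l * u l 0.
have zz0 : 0 <= zz by apply: sumr_ge0 => l _; rewrite mulr_ge0 ?z0.
have Bu : B *m u = a by rewrite mulmxA (mulmx1C BB) mul1mx.
seq; apply: run_conseq; first exact: price_spec.
move=> A1 f1 [hu hred hcz].
have eu (l : 'I_n) : ar A1 xu l = u l 0.
  by rewrite hu // mxE; apply: eq_bigr => j _; rewrite !mxE.
have {}hred : ar A1 xred 0%N = ca - cu.
  rewrite hred; congr (_ - _); apply: eq_bigr => l _.
  by rewrite -hu // eu.
have {}hcz : ar A1 xcz 0%N = alpha * ca + zz by rewrite hcz.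
have eal1 : ar A1 xalpha 0%N = alpha by rewrite (proj2 f1 xalpha isT).
have ez1 : ar A1 xz = ar A xz by rewrite (proj2 f1 xz isT).
seq; apply: run_conseq.
  apply: ratio_test_spec; rewrite ?ez1 ?eal1 ?hcz //.
    by move=> l ln; exact: (z0 (Ordinal ln)).
  by rewrite addr_ge0 // mulr_ge0.
move=> A2 f2; rewrite hred eal1 hcz ez1 /=.
set red := ca - cu; set th := ar A2 xth 0%N; set sg := ar A2 xsg 0%N.
move=> [esg /andP[th0 thle] zpos hp].
have eu2 : ar A2 xu = ar A1 xu by rewrite (proj2 f2 xu isT).
have ez2 : ar A2 xz = ar A xz by rewrite (proj2 f2 xz isT).
seq; apply: run_conseq; first exact: move_basic_spec.
move=> A3 f3 hz3.
pose zt (l : 'I_n) := z l + th * (sg * u l 0).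
have {}hz3 (l : 'I_n) : ar A3 xz l = zt l by rewrite hz3 // eu2 ez2 eu.
have zt0 l : 0 <= zt l by rewrite /zt -eu; exact: zpos.
have Bzt : B *m (\col_l zt l) = b + (th * sg) *: a.
  rewrite -Bu -Bz scalemxAr -mulmxDr; congr (_ *m _).
  by apply/colP => l; rewrite [LHS]mxE [RHS]mxE [cvec _ _ _ _]mxE [X in _ + X]mxE /zt mulrA.
have Czt : \sum_(l < n) cost l * zt l = zz + th * sg * cu.
  rewrite mulr_sumr -big_split /=; apply: eq_bigr => l _.
  by rewrite /zt; ring.
have ep : an A3 vp = an A2 vp by rewrite (proj1 f3 vp isT).
have esets : an A3 vsets = an A vsets.
  by rewrite (proj1 f3 vsets isT) (proj1 f2 vsets isT) (proj1 f1 vsets isT).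
have eS : an A3 vS = an A vS.
  by rewrite (proj1 f3 vS isT) (proj1 f2 vS isT) (proj1 f1 vS isT).
have eB : ar A3 xB = ar A xB.
  by rewrite (proj2 f3 xB isT) (proj2 f2 xB isT) (proj2 f1 xB isT).
have ecost : ar A3 xcost = ar A xcost.
  by rewrite (proj2 f3 xcost isT) (proj2 f2 xcost isT) (proj2 f1 xcost isT).
have eca : ar A3 xca = ar A xca.
  by rewrite (proj2 f3 xca isT) (proj2 f2 xca isT) (proj2 f1 xca isT).
have eal : ar A3 xalpha = ar A xalpha.
  by rewrite (proj2 f3 xalpha isT) (proj2 f2 xalpha isT) (proj2 f1 xalpha isT).
have eth : ar A3 xth 0%N = th by rewrite (proj2 f3 xth isT).
have esg3 : ar A3 xsg 0%N = sg by rewrite (proj2 f3 xsg isT).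
have eu3 (l : 'I_n) : ar A3 xu l = u l 0 by rewrite (proj2 f3 xu isT) eu2 eu.
branch; rewrite ep.
- move=> pn; case: hp => [[_ eth0]|[]]; last by rewrite ltnNge pn.
  apply: run_skip.
  move: eth0 esg thle; case: ifP => [red0|/negbT]; last rewrite -ltNge => red0.
    move=> eth0 esg _; exists B; split.
    + by rewrite /binv eB.
    + by move=> l; rewrite /aset esets ecost; exact: Bc.
    + by move=> l; rewrite hz3.
    + have -> : cvec A3 xz = \col_l zt l by apply/colP => l; rewrite [LHS]mxE [RHS]mxE hz3.
      by rewrite Bzt esg mulr1 eth0.
    + under eq_bigr do rewrite hz3 ecost; rewrite Czt esg mulr1 eth0.
      apply: lerD => //; rewrite ler_wpM2l //.
      by move: red0; rewrite subr_ge0.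
  (* No row blocked although the entering column was increased: the cost
     [alpha * ca + zz + th * red] would then equal [red < 0]. *)
  move=> eth0 esg _; exfalso.
  have : 0 <= \sum_(l < n) cost l * zt l by apply: sumr_ge0 => l _; rewrite mulr_ge0.
  rewrite Czt esg mulrN1 => h0.
  have E : th * - red = alpha * ca + zz - red.
    by rewrite eth0 mulrDl divfK ?mul1r // oppr_eq0 lt_eqF.
  have h1 : 0 <= th * ca by rewrite mulr_ge0.
  have h2 : 0 <= alpha * ca by rewrite mulr_ge0.
  have h3 : th * - red = th * cu - th * ca by rewrite /red; ring.
  move: E red0; rewrite h3 /red => E red0; clear - E red0 h0 h1 h2; lra.
- rewrite -ltnNge => pn; case: hp => [[E]|[_]]; first by rewrite E ltnn in pn.
  move: pn; set pp := an A2 vp 0%N => pn.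
  pose p := Ordinal pn; rewrite /= -[pp]/(nat_of_ord p) eu => -[up zp].
  have ep3 : an A3 vp 0%N = p by rewrite ep.
  have sr : 0 <= sg * red.
    rewrite esg; case: ifP => [|/negbT]; first by rewrite mul1r.
    by rewrite -ltNge mulN1r oppr_ge0 => /ltW.
  have sg2 : 0 <= alpha - sg * th.
    move: thle; rewrite esg; case: ifP => _ h; first by rewrite mul1r subr_ge0.
    by rewrite mulN1r opprK addr_ge0.
  apply: run_conseq; first by apply: exchange_spec; rewrite ep3.
  move=> A4 f4 []; rewrite ep3 eca eal esg3 eth eB ecost -/ca -/alpha => hz hc hB hs.
  have {}hz (l : 'I_n) : ar A4 xz l = if l == p then alpha - sg * th else zt l.
    by rewrite hz hz3.
  pose B' := \matrix_(i, j) if j == p then a i 0 else B i j.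
  have ztp : zt p = 0 by [].
  exists B'; split.
  + apply: (exchange_inverse (Bi := binv A) (B := B) (a := a) (u := u) (p := p)) => //.
      by move=> i j; rewrite [LHS]mxE hB // !eu3; congr (_ - _ * (_ / _)); rewrite mxE.
    by move=> i j; rewrite mxE.
  + move=> l; rewrite hs // hc.
    have [->|ne] := eqVneq l p.
      rewrite eqxx /=.
      have -> : col p B' = a by apply/colP => i; rewrite !mxE eqxx.
      move: ac; rewrite -/ca; case: ltP => ca1 [SF h].
        by rewrite /aset eS; split.
      split.
        by rewrite /aset esets; exact: (proj1 (Bc p)).
      case: h => [[h]|]; first by move: (lt_le_trans h ca1); rewrite ltxx.
      by right.
    have -> : (l == p :> nat) = false by apply/negbTE.
    have -> : col l B' = col l B by apply/colP => i; rewrite !mxE (negbTE ne).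
    by rewrite /= /aset esets; exact: Bc.
  + by move=> l; rewrite hz; case: ifP.
  + apply/colP => i; rewrite mxE.
    have := congr1 (fun v : 'cV_n => v i 0) Bzt; rewrite mxE => Ei.
    transitivity (\sum_j (if j == p then a i 0 * (alpha - sg * th)
                           else B i j * (\col_l zt l) j 0)).
      apply: eq_bigr => j _; rewrite !mxE hz.
      by case: ifP.
    rewrite sum_replace Ei !mxE ztp mulr0 subr0; ring.
  + have -> : \sum_(l < n) ar A4 xcost l * ar A4 xz l =
        \sum_(l < n) (if l == p then ca * (alpha - sg * th) else cost l * zt l).
      by apply: eq_bigr => l _; rewrite hc hz -val_eqE; case: ifP.
    rewrite sum_replace Czt ztp mulr0 subr0.
    have h0 : 0 <= th * (sg * red) by rewrite mulr_ge0.
    have h1 : zz <= C by [].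
    have E : th * (sg * red) = th * sg * ca - th * sg * cu by rewrite /red; ring.
    have -> : ca * (alpha - sg * th) = alpha * ca - th * sg * ca by ring.
    by clear - h0 h1 E; lra.
Qed.
End Absorb.

(** * The covering program and the multiplicative weights *)

Section CoverLP.

Variables (R : realType) (n : nat) (F : {set {set 'I_n}}).
Variables (c : {set 'I_n} -> R) (OPT : R).
Hypothesis cost_range : forall S, S \in F -> 0 < c S <= 1.

Lemma cover_lhs (x : 'cV[R]_#|F|) i :
  (incidence R F *m x) i 0 = \sum_j (i \in member j)%:R * x j 0.
Proof. by rewrite mxE; apply: eq_bigr => j _; rewrite mxE. Qed.

Lemma cover_feasibleP (x : 'cV[R]_#|F|) :
  lp_feasible (cover_mx R F) (cover_rhs R F) x <->
  (forall i, 1 <= \sum_j (i \in member j)%:R * x j 0) /\ (forall j, 0 <= x j 0).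
Proof.
rewrite /lp_feasible /cover_mx /cover_rhs mul_col_mx mul1mx; split.
  move=> h; split=> [i|j].
    by have := h (lshift _ i); rewrite !col_mxEu cover_lhs mxE.
  by have := h (rshift _ j); rewrite !col_mxEd mxE.
move=> [h1 h2] i; case: (split_ordP i) => j ->.
  by rewrite !col_mxEu cover_lhs mxE.
by rewrite !col_mxEd mxE.
Qed.

Lemma memberP (j : 'I_#|F|) : member j \in F.
Proof. exact: enum_valP. Qed.

Lemma member_exists S : S \in F -> exists j : 'I_#|F|, member j = S.
Proof. by move=> SF; exists (enum_rank_in SF S); rewrite /member enum_rankK_in. Qed.

Lemma lp_costE (x : 'cV[R]_#|F|) :
  lp_cost (cost_vec F c) x = \sum_j c (member j) * x j 0.
Proof. by apply: eq_bigr => j _; rewrite mxE. Qed.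

Hypothesis OPTmin : lp_minimum (cover_mx R F) (cover_rhs R F) (cost_vec F c) OPT.

Lemma element_covered (i : 'I_n) : exists2 S, S \in F & i \in S.
Proof.
have [[x /cover_feasibleP[h1 _] _] _] := OPTmin.
have /existsP[j ij] : [exists j : 'I_#|F|, i \in member j].
  apply: contraLR isT => /existsPn h; have := h1 i.
  rewrite big1 ?ler10 // => j _; by rewrite (negbTE (h j)) mul0r.
by exists (member j) => //; exact: memberP.
Qed.

Lemma OPT_gt0 : (0 < n)%N -> 0 < OPT.
Proof.
move=> n0; have [[x /cover_feasibleP[h1 h2] <-] _] := OPTmin.
have t0 (j : 'I_#|F|) : 0 <= c (member j) * x j 0.
  by have /andP[/ltW h _] := cost_range (memberP j); rewrite mulr_ge0.
rewrite lp_costE lt_def sumr_ge0 // andbT; apply/eqP => E.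
have z j : x j 0 = 0.
  have /eqP : c (member j) * x j 0 = 0.
    by apply: (psumr_eq0P (P := xpredT) _ E).
  rewrite mulf_eq0 => /orP[|/eqP//].
  by have /andP[h _] := cost_range (memberP j); rewrite gt_eqF.
have := h1 (Ordinal n0); rewrite big1 ?ler10 // => j _; by rewrite z mulr0.
Qed.

(** Take for every element one set containing it; each costs at most [1]. *)
Lemma OPT_le : OPT <= n%:R.
Proof.
have ex (i : 'I_n) : exists j : 'I_#|F|, i \in member j.
  by have [S /member_exists[j <-] ij] := element_covered i; exists j.
pose f i := xchoose (ex i).
have Hf i : i \in member (f i) := xchooseP (ex i).
pose x : 'cV[R]_#|F| := \col_j \sum_i (f i == j)%:R.
have sumf (g : 'I_#|F| -> R) : \sum_j g j * x j 0 = \sum_i g (f i).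
  under eq_bigr do rewrite mxE mulr_sumr.
  rewrite exchange_big /=; apply: eq_bigr => i _.
  rewrite (bigD1 (f i)) //= eqxx mulr1 big1 ?addr0 // => j ne.
  by rewrite eq_sym (negbTE ne) mulr0.
have /(proj2 OPTmin) h : lp_feasible (cover_mx R F) (cover_rhs R F) x.
  apply/cover_feasibleP; split=> [i|j]; last by rewrite mxE sumr_ge0.
  rewrite (sumf (fun j => (i \in member j)%:R)) (bigD1 i) //= Hf lerDl.
  by rewrite sumr_ge0.
apply: le_trans h _; rewrite lp_costE sumf.
have -> : n%:R = \sum_(i < n) 1 :> R by rewrite sumr_const card_ord.
apply: ler_sum => i _; by have /andP[] := cost_range (memberP (f i)).
Qed.

Lemma weight_ge0 (y : 'rV[rat]_n) S :
  (forall i, 0 <= y 0 i) -> 0 <= weight R y S.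
Proof. by move=> y0; rewrite sumr_ge0 // => i _; rewrite ler0q. Qed.

Lemma weight_le_max_ratio (y : 'rV[rat]_n) S : S \in F ->
  weight R y S <= c S * max_ratio F c y.
Proof.
move=> SF; have /andP[c0 _] := cost_range SF.
rewrite -ler_pdivrMl // /max_ratio.
exact: (le_bigmax_cond _ (fun S => (c S)^-1 * weight R y S) SF).
Qed.

(** Weak duality: [y] divided by its maximal ratio is feasible for the dual packing program. *)
Lemma max_ratio_lb (y : 'rV[rat]_n) : (forall i, 0 <= y 0 i) ->
  \sum_i ratr (y 0 i) <= OPT * max_ratio F c y.
Proof.
move=> y0; have [[x /cover_feasibleP[h1 h2] <-] _] := OPTmin.
rewrite lp_costE mulr_suml.
apply: (@le_trans _ _ (\sum_j weight R y (member j) * x j 0)); last first.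
  apply: ler_sum => j _; rewrite mulrAC ler_wpM2r //.
  exact: weight_le_max_ratio (memberP j).
have -> : \sum_j weight R y (member j) * x j 0 =
    \sum_i ratr (y 0 i) * \sum_j (i \in member j)%:R * x j 0.
  under [RHS]eq_bigr do rewrite mulr_sumr.
  rewrite exchange_big /=; apply: eq_bigr => j _.
  rewrite /weight mulr_suml big_mkcond /=; apply: eq_bigr => i _.
  by case: ifP => _; rewrite ?mul1r // mul0r mulr0.
apply: ler_sum => i _; rewrite -[leLHS]mulr1 ler_wpM2l //.
by rewrite ler0q.
Qed.

(** As [c S <= 1], both accepted guarantees bound the ratio of weight to cost; weak duality then
    replaces the maximal ratio by the average [\sum_i y_i / OPT]. *)
Lemma near_optimal_ratio (y : 'rV[rat]_n) (e : R) S :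
  (forall i, 0 <= y 0 i) -> e <= 1 -> 0 < OPT -> near_optimal F c y e S ->
  (1 - e) * (\sum_i ratr (y 0 i)) * c S <= OPT * weight R y S.
Proof.
move=> y0 e1 O0 [SF h].
have /andP[c0 c1] := cost_range SF.
have w0 := weight_ge0 S y0.
have wc : weight R y S <= (c S)^-1 * weight R y S.
  by rewrite ler_peMl // invf_ge1.
have {}h : (1 - e) * max_ratio F c y <= (c S)^-1 * weight R y S.
  by case: h => // h; exact: le_trans wc.
have {}h : (1 - e) * max_ratio F c y * c S <= weight R y S.
  apply: le_trans (ler_wpM2r (ltW c0) h) _.
  by rewrite mulrAC mulVf ?mul1r // gt_eqF.
apply: le_trans (ler_wpM2l (ltW O0) h).
rewrite mulrA [OPT * _]mulrCA ler_wpM2r ?ler_wpM2l ?subr_ge0 ?(ltW c0) //.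
exact: max_ratio_lb.
Qed.

End CoverLP.

(** * Exponential inequalities and the potential *)

Lemma expR_pow2_le (R : realType) (k : nat) : 2 ^+ k <= expR k%:R :> R.
Proof.
rewrite -[k%:R]mulr1 expRM_natl lerXn2r ?nnegrE ?expR_ge0 //.
by apply: le_trans (expR_ge1Dx 1); rewrite -natr1.
Qed.

(** A converse of [1 - x <= expR (- x)], needed to bound [(1 - 1/N) ^ M] from below. It follows from
    [(1 - x) * (1 + x + 2 * x^2) = 1 + x^2 * (1 - 2 * x) >= 1]. *)
Lemma expR_le_1B (R : realType) (x : R) : 0 <= x <= 2^-1 ->
  expR (- (x + 2 * x ^+ 2)) <= 1 - x.
Proof.
move=> /andP[x0 x1]; rewrite expRN.
have E := expR_ge1Dx (x + 2 * x ^+ 2).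
have E0 : 0 < expR (x + 2 * x ^+ 2) := expR_gt0 _.
rewrite -[leLHS]mul1r ler_pdivrMr //.
have h : 1 <= (1 - x) * (1 + (x + 2 * x ^+ 2)).
  have -> : (1 - x) * (1 + (x + 2 * x ^+ 2)) = 1 + x ^+ 2 * (1 - 2 * x) by ring.
  rewrite lerDl mulr_ge0 ?sqr_ge0 //; lra.
apply: le_trans h _; rewrite ler_wpM2l //; lra.
Qed.

(* One round of multiplicative weights: a set that is at least [1 - e] times as
   efficient as the average set of an optimal solution shrinks the potential by
   a factor [expR (- kappa * cost)]. *)
Lemma potential_step (R : realType) (OPT e N C W W' w cS n : R) :
  0 < OPT -> 0 < N -> 0 <= W ->
  W <= n * expR (- ((1 - e) / (N * OPT) * C)) ->
  W' <= W - w / N ->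
  (1 - e) * W * cS <= OPT * w ->
  W' <= n * expR (- ((1 - e) / (N * OPT) * (C + cS))).
Proof.
move=> O0 N0 W0 hW hW' hw; set k := (1 - e) / (N * OPT) in hW *.
have kE : k * cS * W <= w / N.
  have -> : k * cS * W = (1 - e) * W * cS / (OPT * N).
    by rewrite /k; field; rewrite !gt_eqF.
  rewrite ler_pdivrMr ?mulr_gt0 //.
  by have -> : w / N * (OPT * N) = OPT * w by field; rewrite gt_eqF.
rewrite mulrDr opprD expRD mulrA.
apply: (@le_trans _ _ (W * expR (- (k * cS)))).
  apply: (@le_trans _ _ (W * (1 + - (k * cS)))); first lra.
  by rewrite ler_wpM2l // expR_ge1Dx.
by rewrite ler_wpM2r // expR_ge0.
Qed.

(* As long as more than [delta / 4] elements are active, each of weight at least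
   [(1 - 1/N) ^ M], the potential is large, hence the cost is small. *)
Lemma cost_of_large_potential (R : realType) (OPT delta C n : R) (L : nat) :
  let N := 2 ^+ L in let e := delta / (16 * n) in let M := N * N * L%:R in
  0 < OPT <= n -> 0 < delta <= n / 2 -> 16 * n <= N * delta ->
  delta / 4 * (1 - N^-1) ^+ (2 ^ L * 2 ^ L * L) <=
    n * expR (- ((1 - e) / (N * OPT) * C)) ->
  C <= M * (OPT + 5 / 16 * delta).
Proof.
move=> N e M /andP[O0 On] /andP[d0 dn] Nd h.
have n0 : 0 < n by lra.
have N0 : 0 < N by rewrite exprn_gt0.
have N32 : 32 <= N.
  have : 32 * delta <= N * delta by lra.
  by rewrite ler_pM2r.
have eE : e * (16 * n) = delta by rewrite /e divfK // mulf_neq0 // gt_eqF.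
have e0 : 0 < e by rewrite divr_gt0 // mulr_gt0.
have e1 : e <= 32^-1.
  by rewrite /e ler_pdivrMr ?mulr_gt0 //; lra.
have Ne : N^-1 <= e.
  rewrite -[N^-1]mul1r ler_pdivrMr // /e mulrAC ler_pdivlMr ?mulr_gt0 //.
  by rewrite mul1r mulrC [delta * _]mulrC mulrC.
have x0 : 0 <= N^-1 <= 2^-1.
  by rewrite invr_ge0 ltW //= lef_pV2 ?posrE //; lra.
set kap := (1 - e) / (N * OPT) in h.
have k0 : 0 < kap by rewrite divr_gt0 ?mulr_gt0 //; lra.
have M0 : 0 <= M by rewrite !mulr_ge0 // ltW.
(* With [M = N * N * L], the two terms of [1/N + 2 / N^2] contribute [N * L] and [2 * L]; the third
   [L] bounds the logarithm of [4 * n / delta <= N = 2 ^ L]. *)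
have h1 : kap * C <= N * L%:R + 3 * L%:R.
  have E1 : expR (- (N * L%:R + 2 * L%:R)) <= (1 - N^-1) ^+ (2 ^ L * 2 ^ L * L).
    have -> : - (N * L%:R + 2 * L%:R) =
        (2 ^ L * 2 ^ L * L)%:R * - (N^-1 + 2 * (N^-1) ^+ 2).
      by rewrite !natrM !natrX -/N; field; rewrite gt_eqF.
    rewrite expRM_natl lerXn2r ?nnegrE ?expR_ge0 //; first by lra.
    exact: expR_le_1B.
  have E2 : delta / 4 * expR (- (N * L%:R + 2 * L%:R)) <= n * expR (- (kap * C)).
    by apply: le_trans h; rewrite ler_wpM2l // divr_ge0 // ltW.
  have E3 : delta * expR (- (N * L%:R + 2 * L%:R)) <=
            delta * expR (L%:R - kap * C).
    have : n * expR (- (kap * C)) <= N * delta / 16 * expR (- (kap * C)).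
      by rewrite ler_wpM2r ?expR_ge0 //; lra.
    rewrite expRD => E3.
    have : N * (delta * expR (- (kap * C))) <=
           expR L%:R * (delta * expR (- (kap * C))).
      by rewrite ler_wpM2r ?expR_pow2_le // mulr_ge0 ?expR_ge0 // ltW.
    have : 0 <= N * (delta * expR (- (kap * C))).
      by rewrite !mulr_ge0 ?expR_ge0 ?ltW.
    lra.
  by rewrite ler_pM2l // ler_expR in E3; lra.
have h2 : (1 - e) * C <= OPT * (M * (1 + 3 * e)).
  have NO : 0 < N * OPT by rewrite mulr_gt0.
  have -> : (1 - e) * C = kap * C * (N * OPT).
    by rewrite /kap; field; rewrite !gt_eqF.
  apply: le_trans (ler_wpM2r (ltW NO) h1) _.
  have -> : (N * L%:R + 3 * L%:R) * (N * OPT) = OPT * (M * (1 + 3 * N^-1)).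
    by rewrite /M; field; rewrite gt_eqF.
  apply: ler_wpM2l; first exact: ltW.
  apply: ler_wpM2l => //; lra.
(* Uses [1 + 3 * e <= (1 - e) * (1 + 5 * e)], valid for [0 <= e <= 1/5]. Afterwards [OPT <= n] turns
   [5 * e * OPT] into [5 / 16 * delta]. *)
have h3 : (1 - e) * C <= (1 - e) * (M * OPT * (1 + 5 * e)).
  apply: le_trans h2 _.
  have -> : OPT * (M * (1 + 3 * e)) = M * OPT * (1 + 3 * e) by ring.
  have -> : (1 - e) * (M * OPT * (1 + 5 * e)) =
     M * OPT * ((1 - e) * (1 + 5 * e)) by ring.
  apply: ler_wpM2l; first by rewrite mulr_ge0 // ltW.
  have -> : (1 - e) * (1 + 5 * e) = 1 + 3 * e + e * (1 - 5 * e) by ring.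
  by rewrite lerDl mulr_ge0 ?ltW //; lra.
have e2 : 0 < 1 - e by lra.
rewrite ler_pM2l // in h3; apply: le_trans h3 _.
rewrite -mulrA; apply: ler_wpM2l => //; rewrite mulrDr mulr1 lerD2l.
have : OPT * (5 * e) <= n * (5 * e) by rewrite ler_wpM2r //; lra.
lra.
Qed.

(** * From a basis to a basic solution *)

Lemma rank_full_col (K : fieldType) (p m : nat) (A : 'M[K]_(p, m)) :
  (forall u : 'cV[K]_m, A *m u = 0 -> u = 0) -> \rank A = m.
Proof.
move=> h; apply/eqP; rewrite -mxrank_tr -/(row_free _) -kermx_eq0.
apply/rowV0P => v /sub_kermxP vA; apply: trmx_inj; rewrite trmx0; apply: h.
by apply: trmx_inj; rewrite trmx_mul trmxK trmx0.
Qed.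

Section BasicSolution.

Variables (R : realType) (n : nat) (F : {set {set 'I_n}}).
Variables (c : {set 'I_n} -> R).
Variables (Bi B : 'M[R]_n) (S : 'I_n -> {set 'I_n}) (w z : 'I_n -> R) (M : R).
Hypothesis M_gt0 : 0 < M.
Hypothesis BB : Bi *m B = 1%:M.
Hypothesis Bcol : forall l, column F c (S l) (w l) (col l B).
Hypothesis z_ge0 : forall l, 0 <= z l.
Hypothesis Bz : B *m (\col_l z l) = const_mx M.

(** A slack entry carries an arbitrary set of the family, possibly that of another entry: it gets
    the value [0], and [x] sums over all entries with the same set. *)
Let z' l := if w l <= 0 then 0 else z l / M.
Let x : 'cV[R]_#|F| := \col_j \sum_(l | S l == member j) z' l.

Let zM_ge0 l : 0 <= z l / M.
Proof. by rewrite divr_ge0 // ltW. Qed.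

Let z'_ge0 l : 0 <= z' l.
Proof. by rewrite /z'; case: ifP. Qed.

Lemma col_basis_inj : injective (fun l => col l B).
Proof.
move=> l l' E.
have : col l (Bi *m B) = col l' (Bi *m B) by rewrite !colE -!mulmxA -!colE E.
rewrite BB => /(congr1 (fun v : 'cV_n => v l 0)).
by rewrite !mxE eqxx; case: eqP => // _ /eqP; rewrite oner_eq0.
Qed.

Lemma sum_entries (g : 'I_#|F| -> R) (h : {set 'I_n} -> R) (v : 'I_n -> R) :
  (forall j, g j = h (member j)) ->
  \sum_j g j * \sum_(l | S l == member j) v l = \sum_l h (S l) * v l.
Proof.
move=> gh; under eq_bigr do rewrite mulr_sumr big_mkcond.
rewrite exchange_big /=; apply: eq_bigr => l _.
have [j0 Ej0] := member_exists (proj1 (Bcol l)).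
rewrite (bigD1 j0) //= Ej0 eqxx gh Ej0 big1 ?addr0 // => j ne.
case: eqP => // E; case/eqP: ne; apply: enum_val_inj; rewrite -/(member _) -/(member _).
by rewrite -E.
Qed.

Lemma entry_cost l : c (S l) * z' l = w l * z l / M.
Proof.
have [_ [[w0 wE _]|[w0 _]]] := Bcol l; rewrite /z'.
  by rewrite leNgt w0 /= -wE mulrA.
by rewrite w0 lexx mulr0 !mul0r.
Qed.

Lemma basis_cost : lp_cost (cost_vec F c) x = (\sum_l w l * z l) / M.
Proof.
rewrite lp_costE; under eq_bigr do rewrite mxE.
rewrite (sum_entries _ (h := c)) // mulr_suml.
by apply: eq_bigr => l _; rewrite entry_cost.
Qed.

(** Column [l] is the slack [- e_i]: a slack column has a single nonzero entry. *)
Let slack i l := (w l <= 0) && (B i l != 0).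

Lemma B_entry i l :
  B i l = if w l <= 0 then - (slack i l)%:R else (i \in S l)%:R.
Proof.
have [_ [[w0 _ E]|[w0 [k E]]]] := Bcol l.
  rewrite leNgt w0 /=; have := congr1 (fun v : 'cV_n => v i 0) E.
  by rewrite !mxE.
rewrite /slack w0 lexx /=; have := congr1 (fun v : 'cV_n => v i 0) E.
rewrite !mxE => ->.
by case: (i == k); rewrite /= ?oppr_eq0 ?oner_eq0 ?eqxx /= ?oppr0.
Qed.

Lemma slack_uniq i l l' : slack i l -> slack i l' -> l = l'.
Proof.
have key m : slack i m -> col m B = - delta_mx i 0.
  move=> /andP[w0 nz].
  have [_ [[w1 _ _]|[_ [k E]]]] := Bcol m; first by rewrite leNgt w1 in w0.
  rewrite E; have := congr1 (fun v : 'cV_n => v i 0) E; rewrite !mxE => Ei.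
  by move: nz; rewrite Ei; case: (i =P k) => [->//|_]; rewrite oppr0 eqxx.
by move=> /key h /key h'; apply: col_basis_inj; rewrite /= h h'.
Qed.

Lemma set_uniq l l' : 0 < w l -> 0 < w l' -> S l = S l' -> l = l'.
Proof.
move=> h h' E; apply: col_basis_inj; rewrite /=.
apply/colP => i; rewrite !mxE !B_entry !leNgt h h' /=.
by rewrite E.
Qed.

(** This is row [i] of [B *m z = M], divided by [M], with the slack terms moved to the other side.
    In particular an element without slack in the basis is covered exactly. *)
Lemma cover_value i : (incidence R F *m x) i 0 = 1 + \sum_(l | slack i l) z l / M.
Proof.
rewrite cover_lhs; under eq_bigr do rewrite mxE.
rewrite (sum_entries _ (h := fun T => (i \in T)%:R)) //.
have := congr1 (fun v : 'cV_n => v i 0) Bz; rewrite !mxE => E.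
have {}E : \sum_l B i l * (z l / M) = 1.
  rewrite -(divff (lt0r_neq0 M_gt0)) -[X in _ = X / _]E mulr_suml.
  by apply: eq_bigr => l _; rewrite mxE mulrA.
rewrite -[X in _ = X + _]E [X in _ = _ + X]big_mkcond -big_split /=; apply: eq_bigr => l _.
rewrite B_entry /z'; case: ifP => w0; last first.
  by rewrite /slack w0 addr0.
by case: (slack i l); rewrite mulr0 ?mulN1r ?addNr // oppr0 mul0r addr0.
Qed.

Lemma basis_feasible : lp_feasible (cover_mx R F) (cover_rhs R F) x.
Proof.
apply/cover_feasibleP; split=> [i|j].
  by rewrite -cover_lhs cover_value lerDl sumr_ge0.
by rewrite mxE sumr_ge0.
Qed.

(** A vector [u] killed by the active rows vanishes at every set outside the basis, where [x] is
    [0], and [incidence *m u] vanishes at every element without a basic slack, where the covering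
    constraint is tight. So [u] together with its covering excesses is a combination [q] of basic
    columns equal to [0], and invertibility gives [q = 0]. *)
Lemma basis_basic : basic_solution (cover_mx R F) (cover_rhs R F) x.
Proof.
split; first exact: basis_feasible.
apply: rank_full_col => u Au.
have row0 k (i : 'I_(n + #|F|)) : (cover_mx R F *m x) i 0 = cover_rhs R F i 0 ->
    k = (cover_mx R F *m u) i 0 -> k = 0.
  move=> tight ->; have := congr1 (fun v : 'cV_(n + #|F|) => v i 0) Au.
  rewrite [in RHS]mxE => <-; rewrite [LHS]mxE [RHS]mxE.
  by apply: eq_bigr => j _; rewrite [active_rows _ _ _ _ _]mxE tight eqxx.
have u_supp j : u j 0 != 0 -> exists2 l, 0 < w l & S l = member j.
  move=> uj; have : x j 0 != 0.
    apply: contraNneq uj => xj; apply/eqP; apply: (row0 _ (rshift n j)).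
      by rewrite /cover_mx /cover_rhs mul_col_mx mul1mx !col_mxEd xj mxE.
    by rewrite /cover_mx mul_col_mx mul1mx col_mxEd.
  rewrite mxE => /eqP nz; have /existsP[l /andP[Sl wl]] :
      [exists l, (S l == member j) && (0 < w l)].
    apply: contra_notT nz => /existsPn h; rewrite big1 // => l Sl.
    by have := h l; rewrite Sl -leNgt /= /z' => ->.
  by exists l => //; exact/eqP.
have slack_ex i : (incidence R F *m u) i 0 != 0 -> exists l, slack i l.
  move=> nz; apply/existsP; apply: contraNT nz => /existsPn h.
  apply/eqP; apply: (row0 _ (lshift _ i)).
    rewrite /cover_mx /cover_rhs mul_col_mx !col_mxEu cover_value mxE.
    by rewrite big_pred0 ?addr0 // => l; apply/negbTE/h.
  by rewrite /cover_mx mul_col_mx col_mxEu.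
(* Both inner sums pick out a single term: the element of the slack [l], respectively the index of
   the set [S l]. *)
pose q : 'cV[R]_n := \col_l (if w l <= 0
  then \sum_(i | slack i l) (incidence R F *m u) i 0
  else \sum_(j | S l == member j) u j 0).
have Bq : B *m q = 0.
  apply/colP => i; rewrite !mxE.
  transitivity (\sum_(l | 0 < w l) (i \in S l)%:R * \sum_(j | S l == member j) u j 0
     - \sum_(l | slack i l) \sum_(i' | slack i' l) (incidence R F *m u) i' 0).
    rewrite [X in _ = X - _]big_mkcond [X in _ = _ - X]big_mkcond -sumrB /=.
    apply: eq_bigr => l _; rewrite mxE B_entry; rewrite ltNge.
    case: ifP => w0 /=; last by rewrite /slack w0 subr0.
    by case: ifP => _; rewrite ?mulN1r sub0r // !oppr0 mul0r.
  have -> : \sum_(l | slack i l) \sum_(i' | slack i' l) (incidence R F *m u) i' 0 =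
      (incidence R F *m u) i 0.
    have inner l : slack i l ->
        \sum_(i' | slack i' l) (incidence R F *m u) i' 0 = (incidence R F *m u) i 0.
      move=> sl; rewrite (big_pred1 i) // => i' /=.
      apply/idP/eqP => [|->//] /andP[w0 nz].
      have [_ [[w1 _ _]|[_ [k E]]]] := Bcol l; first by rewrite leNgt w1 in w0.
      have h m : B m l != 0 -> m = k.
        have := congr1 (fun v : 'cV_n => v m 0) E; rewrite !mxE => ->.
        by case: (m =P k) => // _; rewrite oppr0 eqxx.
      by rewrite (h _ nz) (h _ (proj2 (andP sl))).
    rewrite (eq_bigr _ inner).
    have [z0|/slack_ex[l0 sl0]] := eqVneq ((incidence R F *m u) i 0) 0.
      by rewrite z0 big1.
    rewrite (big_pred1 l0) // => l /=.
    by apply/idP/eqP => [sl|->//]; exact: slack_uniq sl sl0.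
  apply/eqP; rewrite subr_eq0 cover_lhs; apply/eqP.
  under eq_bigr do rewrite mulr_sumr big_mkcond.
  rewrite exchange_big /=; apply: eq_bigr => j _.
  have [z0|/u_supp[l0 wl0 Sl0]] := eqVneq (u j 0) 0.
    by rewrite z0 mulr0 big1 // => l _; rewrite mulr0 if_same.
  rewrite -big_mkcondr (big_pred1 l0) ?Sl0 // => l /=.
  apply/andP/eqP => [[wl /eqP Sl]|->]; last by rewrite wl0 Sl0.
  by apply: set_uniq => //; rewrite Sl.
have q0 : q = 0 by rewrite -[q]mul1mx -BB -mulmxA Bq mulmx0.
apply/colP => j; rewrite [RHS]mxE; apply/eqP; apply: contraT => uj.
have [l wl Sl] := u_supp j uj.
have := congr1 (fun v : 'cV_n => v l 0) q0; rewrite !mxE leNgt wl /=.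
rewrite (big_pred1 j) => [E|j' /=]; first by rewrite E eqxx in uj.
by rewrite Sl; apply/eqP/eqP => [/enum_val_inj|->].
Qed.

End BasicSolution.

(** * Multiplicative weights and the cost spent *)

Section Weights.

Variables (R : realType) (n : nat) (F : {set {set 'I_n}}).
Variables (c : {set 'I_n} -> R) (OPT delta : R) (L : nat).
Hypothesis cost_range : forall S, S \in F -> 0 < c S <= 1.
Hypothesis OPT_range : 0 < OPT <= n%:R.
Hypothesis delta_range : 0 < delta <= n%:R / 2.
Hypothesis L_large : 16 * n%:R <= 2 ^+ L * delta.

Notation N := (2 ^ L)%N.
Definition threshold : nat := (N * N * L)%N.
Notation M := threshold.
(** Written as [c0 * delta / n] with [c0 = 16^-1], the form in which it enters the time bound. *)
Definition accuracy : R := 16^-1 * delta / n%:R.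
Notation e := accuracy.

(** The rational witness that an oracle call requires for the real weights in memory. *)
Definition qweight (m : nat) : rat :=
  if (m < M)%N then (1 - N%:R^-1) ^+ m else 0.

Definition weight_of (m : nat) : R :=
  if (m < M)%N then (1 - N%:R^-1) ^+ m else 0.

Lemma ratr_qweight m : ratr (qweight m) = weight_of m.
Proof.
rewrite /qweight /weight_of; case: ifP => _; last by rewrite rmorph0.
by rewrite rmorphXn rmorphB rmorph1 fmorphV rmorph_nat.
Qed.

Lemma n_pos : 0 < n%:R :> R.
Proof. by case/andP: delta_range => *; lra. Qed.

Lemma accuracyE : e = delta / (16 * n%:R).
Proof. by rewrite /e; field; have := n_pos; rewrite lt0r => /andP[]. Qed.

Lemma accuracy_range : 0 < e < 1.
Proof.
have n0 := n_pos; case/andP: delta_range => d0 d1; rewrite accuracyE.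
by rewrite divr_gt0 ?mulr_gt0 //= ltr_pdivrMr ?mulr_gt0 //; lra.
Qed.

Lemma natN : N%:R = 2 ^+ L :> R.
Proof. by rewrite natrX. Qed.

Lemma N_ge32 : 32 <= N%:R :> R.
Proof.
have n0 := n_pos; case/andP: delta_range => d0 d1.
have : 32 * delta <= 2 ^+ L * delta by apply: le_trans L_large; lra.
by rewrite ler_pM2r // natN.
Qed.

Lemma natM : M%:R = 2 ^+ L * 2 ^+ L * L%:R :> R.
Proof. by rewrite !natrM natN. Qed.

Lemma L_gt0 : (0 < L)%N.
Proof.
have := N_ge32; rewrite lt0n; apply: contraTneq => ->.
by rewrite expn0 -ltNge ltr1n.
Qed.

Lemma M_gt0 : (0 < M)%N.
Proof. by rewrite !muln_gt0 !expn_gt0 L_gt0. Qed.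

Lemma q_range : 0 <= 1 - (N%:R : R)^-1 <= 1.
Proof.
have h := N_ge32.
have h0 : 0 < N%:R :> R by lra.
have : N%:R^-1 <= 1 :> R by rewrite invf_le1 //; lra.
have : 0 <= N%:R^-1 :> R by rewrite invr_ge0 ltW.
by move=> *; apply/andP; split; lra.
Qed.

Lemma qweight_ge0 m : 0 <= qweight m.
Proof.
by rewrite -(ler0q R) ratr_qweight /weight_of; case: ifP => // _; rewrite exprn_ge0 //;
  case/andP: q_range.
Qed.

Lemma weight_of_ge0 m : 0 <= weight_of m.
Proof. by rewrite -ratr_qweight ler0q qweight_ge0. Qed.

Lemma weight_of_step m (s : bool) :
  weight_of (m + 1 * s) <= weight_of m - (if s then weight_of m else 0) / N%:R.
Proof.
have w0 := weight_of_ge0 m; have /andP[q0 _] := q_range.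
case: s; rewrite ?muln0 ?muln1 ?addn0 ?mul0r ?subr0 //.
have -> : weight_of m - weight_of m / N%:R = weight_of m * (1 - N%:R^-1) by ring.
rewrite addn1 {1}/weight_of; case: ifP => [mM|_]; last by rewrite mulr_ge0.
by rewrite /weight_of (ltnW mM) exprSr.
Qed.

Lemma weight_of_lb m : (m < M)%N -> (1 - N%:R^-1) ^+ M <= weight_of m.
Proof.
have /andP[q0 q1] := q_range.
by move=> mM; rewrite /weight_of mM ler_wiXn2l // ltnW.
Qed.

Definition active (m : nat -> nat) : nat := (\sum_(i < n) (m i < M)%N)%N.
Definition potential (m : nat -> nat) : R := \sum_(i < n) weight_of (m i).

(** The first alternative is the last phase, with [M] held in reserve for every active element. The
    second is the main phase, where the potential has decayed in proportion to the cost [C]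
    spent. *)
Definition cost_bound (m : nat -> nat) (C : R) : Prop :=
  (4 * (active m)%:R <= delta /\ C + M%:R * (active m)%:R <= M%:R * (OPT + delta)) \/
  (delta < 4 * (active m)%:R /\
   potential m <= n%:R * expR (- ((1 - e) / (2 ^+ L * OPT) * C))).

Lemma active_ext (m m' : nat -> nat) : (forall i : 'I_n, m' i = m i) -> active m' = active m.
Proof. by move=> E; apply: eq_bigr => i _; rewrite E. Qed.

Lemma cost_bound_ext (m m' : nat -> nat) C :
  (forall i : 'I_n, m' i = m i) -> cost_bound m C -> cost_bound m' C.
Proof.
move=> E; rewrite /cost_bound (active_ext E).
by have -> : potential m' = potential m by apply: eq_bigr => i _; rewrite E.
Qed.

Lemma potential_lb m : (active m)%:R * (1 - N%:R^-1) ^+ M <= potential m.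
Proof.
rewrite natr_sum mulr_suml; apply: ler_sum => i _.
by case: ltnP => h; rewrite ?mul1r ?weight_of_lb // mul0r weight_of_ge0.
Qed.

Lemma cost_bound_init : cost_bound (fun=> 0%N) 0.
Proof.
right; have n0 := n_pos; case/andP: delta_range => d0 d1; split.
  rewrite /active sum_nat_const card_ord M_gt0 muln1; lra.
rewrite mulr0 oppr0 expR0 mulr1 /potential sumr_const card_ord.
by rewrite /weight_of M_gt0 expr0.
Qed.

Lemma cost_bound_final m C : active m = 0%N -> cost_bound m C ->
  C <= M%:R * (OPT + delta).
Proof.
case/andP: delta_range => d0 d1.
by move=> a0; rewrite /cost_bound a0 !mulr0 addr0 => -[[]//|[]]; lra.
Qed.

(** Guarantees progress: if [S] contained only discarded elements, its weight would be [0], and the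
    oracle inequality would force the potential to [0]. *)
Lemma covers_active (m : nat -> nat) (S : {set 'I_n}) :
  S \in F -> (0 < active m)%N ->
  (1 - e) * potential m * c S <= OPT * \sum_(i in S) weight_of (m i) ->
  exists2 i, i \in S & (m i < M)%N.
Proof.
move=> SF act hS; have /andP[c0 _] := cost_range SF.
have /andP[_ e1] := accuracy_range.
have q0 : 0 < 1 - (N%:R : R)^-1.
  by rewrite subr_gt0 invf_lt1; have := N_ge32; lra.
apply/exists_inP; apply: contraLR act => h; rewrite -leqNgt.
have : (1 - e) * potential m * c S <= 0.
  apply: le_trans hS _; rewrite big1 ?mulr0 // => i iS.
  rewrite /weight_of ifF //; apply/negbTE.
  by move/exists_inPn: h => /(_ i iS).
rewrite pmulr_lle0 // pmulr_rle0 ?subr_gt0 // => p0.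
have /le_trans/(_ p0) := potential_lb m.
by rewrite pmulr_lle0 ?exprn_gt0 // lern0 => /eqP ->.
Qed.

(** The multiplicity with which the set is taken; [M] copies discard all its elements at once. *)
Definition step (m : nat -> nat) : nat :=
  if 4 * (active m)%:R <= delta then M else 1%N.

Lemma step_gt0 m : (0 < step m)%N.
Proof. by rewrite /step; case: ifP => // _; exact: M_gt0. Qed.

Lemma cost_bound_step (m m' : nat -> nat) (S : {set 'I_n}) C :
  S \in F -> (forall i : 'I_n, m' i = (m i + step m * (i \in S))%N) ->
  (exists2 i, i \in S & (m i < M)%N) ->
  (1 - e) * potential m * c S <= OPT * \sum_(i in S) weight_of (m i) ->
  cost_bound m C -> cost_bound m' (C + (step m)%:R * c S).
Proof.
move=> SF m'E [i0 i0S i0M] hS hC.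
have /andP[c0 c1] := cost_range SF.
have n0 := n_pos; case/andP: delta_range => d0 d1; case/andP: OPT_range => O0 O1.
have M0 : 1 <= M%:R :> R by rewrite ler1n M_gt0.
(* In the last phase [i0] becomes inactive, and the reserve [M] it held pays for [M * c S <= M]. *)
have [/negbTE ph|/negPn ph] := boolP (~~ (4 * (active m)%:R <= delta)); last first.
  have sE : step m = M by rewrite /step ph.
  have lt : (active m' < active m)%N.
    rewrite /active (bigD1 i0) //= [X in (_ < X)%N](bigD1 i0) //= i0M.
    have -> : (m' i0 < M)%N = false by rewrite m'E i0S sE muln1 ltnNge leq_addl.
    rewrite add0n add1n ltnS.
    apply: leq_sum => i _; rewrite m'E.
    case: (ltnP (m i)) => // h; first by case: (_ < _)%N.
    by rewrite ltnNge (leq_trans h) // leq_addr.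
  have ltR : (active m')%:R + 1 <= (active m)%:R :> R.
    by rewrite natr1 ler_nat.
  case: hC => [[h1 h2]|[]]; last by rewrite ltNge ph.
  left; split; first lra.
  rewrite sE; have : M%:R * c S <= M%:R by rewrite ler_piMr // ltW.
  have : M%:R * ((active m')%:R + 1) <= M%:R * (active m)%:R :> R.
    by rewrite ler_wpM2l.
  lra.
have sE : step m = 1%N by rewrite /step ph.
have hC2 : potential m <= n%:R * expR (- ((1 - e) / (2 ^+ L * OPT) * C)).
  by case: hC => [[]|[]//]; rewrite ph.
rewrite sE mul1r.
have N0 : 0 < 2 ^+ L :> R by rewrite exprn_gt0.
have W0 : 0 <= potential m by apply: sumr_ge0 => i _; exact: weight_of_ge0.
have hW : potential m' <= n%:R * expR (- ((1 - e) / (2 ^+ L * OPT) * (C + c S))).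
  apply: (potential_step O0 N0 W0 hC2 _ hS).
  rewrite /potential [X in _ - X / _]big_mkcond mulr_suml -sumrB /= -natN.
  by apply: ler_sum => i _; rewrite m'E sE; exact: weight_of_step.
have [act'|act'] := ltP delta (4 * (active m')%:R); first by right.
left; split => //.
(* The last phase begins here. To [5 / 16 * delta] (times [M]) the present round adds
   [c S <= 1 <= M * delta / 16] and the reserve adds at most [M * delta / 4]. *)
have : C <= M%:R * (OPT + 5 / 16 * delta).
  rewrite natM; apply: (cost_of_large_potential (n := n%:R)); rewrite ?O0 ?d0 //.
  rewrite -accuracyE; apply: le_trans hC2.
  apply: le_trans (potential_lb m); rewrite natN ler_wpM2r //.
    by rewrite exprn_ge0 // -natN; case/andP: q_range.
  by move/negbT: ph; rewrite -ltNge; lra.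
have h1 : 16 * n%:R <= M%:R * delta.
  apply: le_trans L_large _.
  rewrite ler_pM2r // -natN ler_nat /M -mulnA leq_pmulr // muln_gt0 expn_gt0 L_gt0 //.
have h2 : 1 <= n%:R :> R by move: n0; rewrite ltr0n ler1n.
have h3 : M%:R * (4 * (active m')%:R) <= M%:R * delta.
  by rewrite ler_wpM2l.
rewrite !mulrDr; lra.
Qed.

End Weights.

(** * The algorithm *)

Definition eps : srexp := SRDiv (rv xdelta) (SRMul (SOfN (SC 16)) (SOfN SDim)).

(* [delta] is handed over in the first cell of [xz]. *)
Definition start : scom :=
  xdelta :=r rv xz ;; xz :=r zeroE ;; vN :=n SC 1.

(** Doubling until [N * delta >= 16 * n] produces [N] and its binary logarithm together. *)
Definition scale_test : sbexp :=
  SNot (SLeR (SRMul (SOfN (SC 16)) (SOfN SDim)) (SRMul (SOfN (nv vN)) (rv xdelta))).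

Definition scale_body : scom :=
  vN :=n SMul (SC 2) (nv vN) ;; vL :=n SAdd (nv vL) (SC 1).

(** The initial basis consists of the slacks with coefficients [0]. The oracle call serves only to
    obtain some set of the family for the entries of these slacks. *)
Definition setup : scom :=
  vM :=n SMul (SMul (nv vN) (nv vN)) (nv vL) ;;
  SFor vi (SSetR xy (nv vi) oneE ;; SSetR xB (entry vi vi) (SRSub zeroE oneE)) ;;
  SOpt xy eps vS ;;
  SFor vi (SFor vj (SSetN vsets (entry vi vj) (SN vS (nv vj)))) ;;
  vact :=n SDim.

Definition main_test : sbexp := SLeN (SC 1) (nv vact).

(** The factor [1 - 1/N] is the right one for [vstep = 1]. For [vstep = M] the count of every
    element of the set reaches [M], so its weight is reset to [0] anyway. *)
Definition update : scom :=
  vact :=n SC 0 ;;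
  SFor vi (
    SSetR xa (nv vi) (SOfN (SN vS (nv vi))) ;;
    SSetN vm (nv vi) (SAdd (SN vm (nv vi)) (SMul (nv vstep) (SN vS (nv vi)))) ;;
    SSetR xy (nv vi) (SRMul (SR xy (nv vi))
      (SRSub oneE (SRDiv (SOfN (SN vS (nv vi))) (SOfN (nv vN))))) ;;
    SIf (SLeN (nv vM) (SN vm (nv vi)))
      (SSetR xy (nv vi) zeroE)
      (vact :=n SAdd (nv vact) (SC 1))).

Definition main_body : scom :=
  SOpt xy eps vS ;;
  SCost vS xca ;;
  SIf (SLeR (SRMul (SOfN (SC 4)) (SOfN (nv vact))) (rv xdelta))
    (vstep :=n nv vM) (vstep :=n SC 1) ;;
  update ;;
  xalpha :=r SOfN (nv vstep) ;;
  absorb.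

Definition add_slacks : scom :=
  SFor vi (
    SFor vj (SSetR xa (nv vj) zeroE) ;;
    SSetR xa (nv vi) (SRSub zeroE oneE) ;;
    xca :=r zeroE ;;
    xalpha :=r SOfN (SSub (SN vm (nv vi)) (nv vM)) ;;
    absorb).

Definition rescale : scom :=
  SFor vl (SIf (SLeR (SR xcost (nv vl)) zeroE)
    (SSetR xz (nv vl) zeroE)
    (SSetR xz (nv vl) (SRDiv (SR xz (nv vl)) (SOfN (nv vM))))).

Definition finish : scom := add_slacks ;; rescale.

Definition program : com :=
  CSeq (compile start)
 (CSeq (CWhile (compB scale_test) (compile scale_body))
 (CSeq (compile setup)
 (CSeq (CWhile (compB main_test) (compile main_body))
       (compile finish)))).

(** * Correctness of the phases of the program *)

Section Main.

Variables (R : realType) (n : nat) (F : {set {set 'I_n}}).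
Variables (c : {set 'I_n} -> R) (tc : nat) (T : nat -> R -> nat).
Variables (opt : 'rV[rat]_n -> R -> {set 'I_n}) (OPT delta : R) (L : nat).
Hypothesis n_gt0 : (0 < n)%N.
Hypothesis cost_range : forall S, S \in F -> 0 < c S <= 1.
Hypothesis opt_ok : optimizer F c opt.
Hypothesis OPTmin : lp_minimum (cover_mx R F) (cover_rhs R F) (cost_vec F c) OPT.
Hypothesis delta_range : 0 < delta <= n%:R / 2.
Hypothesis L_large : 16 * n%:R <= 2 ^+ L * delta.

Notation e0 := (accuracy n delta).
Notation M := (threshold L).
Notation run := (run F c tc T opt e0).
Notation wt := (weight_of R L).

Lemma OPT_range : 0 < OPT <= n%:R.
Proof. by rewrite (OPT_gt0 cost_range OPTmin n_gt0) (OPT_le cost_range OPTmin). Qed.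

Definition state0 : astate R :=
  setR (AState (fun _ _ => 0%N) (fun _ _ => 0)) xz 0 delta.

Lemma rep_input : rep n (input_state n delta) state0.
Proof.
split=> //= a i lt.
have := block_inj n_gt0 a 0 lt (size_gt0 n_gt0); rewrite mul0n addn0.
by rewrite /upd => ->; case: a.
Qed.

(** The zero cells are used by [setup]: counts, costs, coefficients and the entries of [xB] off the
    diagonal start at [0] without being written. *)
Record scaling (A : astate R) : Prop := Scaling {
  scalingN : an A vN 0%N = (2 ^ an A vL 0)%N;
  scalingL : (an A vL 0 <= L)%N;
  scaling_delta : ar A xdelta 0%N = delta;
  scaling_nat0 : forall b j, b != vN -> b != vL -> an A b j = 0%N;
  scaling_real0 : forall b j, b != xdelta -> ar A b j = 0 }.

Lemma start_spec : run start state0 scaling.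
Proof.
seq; store; seq; store; store; split=> //.
- move=> b j b3 _ /=; case: PeanoNat.Nat.eqb_spec => // E.
  by rewrite E in b3.
- case=> [|b] j b7 /=; first by rewrite !updE; case: eqP.
  case: PeanoNat.Nat.eqb_spec => // E.
  by rewrite E in b7.
Qed.

Lemma scale_spec A : scaling A -> evB n A scale_test ->
  run scale_body A (fun A' => scaling A' /\ (L - an A' vL 0 < L - an A vL 0)%N).
Proof.
move=> [eN lL ed n0 r0]; rewrite /= eN ed natrX -ltNge => h.
have lt : (an A vL 0 < L)%N.
  rewrite ltnNge; apply/negP => h'.
  have := lt_le_trans h L_large; rewrite ltr_pM2r ?ltr_eXn2l ?ltr1n //.
    by rewrite ltnNge h'.
  by case/andP: delta_range.
seq; store; store; rewrite updE eqxx addn1 ltn_sub2l //; split=> //; split=> //=.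
- by rewrite eN -expnS.
- move=> b j b1 b2; rewrite -[RHS](n0 b j b1 b2).
  case: PeanoNat.Nat.eqb_spec => [E|_]; first by rewrite E in b2.
  by case: PeanoNat.Nat.eqb_spec => [E|//]; rewrite E in b1.
Qed.

Lemma setS_in (A : astate R) a (S : {set 'I_n}) (i : 'I_n) :
  an (setS A a S) a i = (i \in S).
Proof.
rewrite /= PeanoNat.Nat.eqb_refl ltn_ord; congr nat_of_bool.
apply/existsP/idP => [[j /andP[jS /eqP E]]|iS]; last by exists i; rewrite iS /=.
by rewrite (val_inj E).
Qed.

Lemma aset_setS (A : astate R) a (S : {set 'I_n}) : aset n (setS A a S) a 0 = S.
Proof. by apply/setP => i; rewrite inE add0n setS_in; case: (i \in S). Qed.

(** [inv_S] is kept for the end, where the absorbed slacks carry the last chosen set. *)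
Record inv (A : astate R) : Prop := Inv {
  inv_delta : ar A xdelta 0%N = delta;
  inv_N : an A vN 0%N = (2 ^ L)%N;
  inv_M : an A vM 0%N = M;
  inv_y : forall i : 'I_n, ar A xy i = wt (an A vm i);
  inv_act : an A vact 0%N = active n L (an A vm);
  inv_S : aset n A vS 0 \in F;
  inv_basis : exists2 C, basis F c A (\col_(i < n) (an A vm i)%:R) C &
                         cost_bound n OPT delta L (an A vm) C }.

Lemma evR_eps (A : astate R) : ar A xdelta 0%N = delta -> evR n A eps = e0.
Proof. by move=> /= ->; rewrite -(accuracyE delta_range). Qed.

Lemma query A (m : nat -> nat) (Q : astate R -> Prop) :
  ar A xdelta 0%N = delta -> (forall i : 'I_n, ar A xy i = wt (m i)) ->
  (forall S, S \in F ->
     (1 - e0) * potential R n L m * c S <= OPT * \sum_(i in S) wt (m i) ->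
     Q (setS A vS S)) ->
  run (SOpt xy eps vS) A Q.
Proof.
move=> ed ey HQ; have /andP[e1 /ltW e2] := accuracy_range delta_range.
pose v : 'rV[rat]_n := \row_i qweight L (m i).
have v0 i : 0 <= v 0 i by rewrite mxE (qweight_ge0 delta_range L_large).
apply (@run_opt _ _ _ _ _ _ _ _ n_gt0 _ _ _ _ v) => //.
- by move=> i; rewrite ey mxE ratr_qweight.
- by rewrite /=; side.
- exact: evR_eps.
- have /andP[O0 _] := OPT_range.
  have no := opt_ok v0 e1.
  apply: HQ; first by case: no.
  have := near_optimal_ratio cost_range OPTmin v0 e2 O0 no.
  have -> : \sum_i ratr (v 0 i) = potential R n L m.
    by apply: eq_bigr => i _; rewrite mxE ratr_qweight.
  by have -> : weight R v (opt v e0) = \sum_(i in opt v e0) wt (m i)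
    by apply: eq_bigr => i _; rewrite mxE ratr_qweight.
Qed.

Lemma setup_spec A : scaling A -> an A vL 0%N = L -> run setup A inv.
Proof.
move=> [eN lL ed n0 r0] eL.
have M0 := M_gt0 delta_range L_large.
seq; store; seq.
loop (fun k (A' : astate R) => (forall i, (i < k)%N -> ar A' xy i = 1) /\
  (forall i j, (i < n)%N -> (j < n)%N -> ar A' xB (i * n + j)%N =
     if (i < k)%N && (i == j) then -1 else 0)) => //.
- by split=> // i j _ _; rewrite /= r0.
- move=> k A1 kn ik f [I1 I2]; seq; store; store; rewrite ik; split.
    move=> i; rewrite ltnS leq_eqVlt updE; case: eqP => //= _; exact: I1.
  move=> i j hi hj; rewrite updE entry_eq // I2 // ltnS.
  have [->|ne] := eqVneq i k; last by rewrite /= [in RHS]leq_eqVlt (negbTE ne).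
  by rewrite leqnn ltnn /= eq_sym; case: eqP; rewrite ?sub0r.
move=> A1 f1 [I1 I2].
have em1 j : an A1 vm j = 0%N by rewrite (proj1 f1 vm isT) /= n0.
have ed1 : ar A1 xdelta 0%N = delta by rewrite (proj2 f1 xdelta isT).
have eN1 : an A1 vN 0%N = (2 ^ L)%N by rewrite (proj1 f1 vN isT) /= eN eL.
have eM1 : an A1 vM 0%N = M by rewrite (proj1 f1 vM isT) /= eN eL.
have ec1 j : ar A1 xcost j = 0 by rewrite (proj2 f1 xcost isT) /= r0.
have ez1 j : ar A1 xz j = 0 by rewrite (proj2 f1 xz isT) /= r0.
seq; apply: (query (m := fun=> 0%N)) => //.
  by move=> i; rewrite I1 // /weight_of M0 expr0.
move=> S SF _; set A2 := setS A1 vS S.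
seq; loop (fun k (A' : astate R) => forall i j, (i < n)%N -> (j < n)%N -> (i < k)%N ->
   an A' vsets (i * n + j)%N = an A2 vS j) => //.
- move=> k A3 kn ik f IS.
  loop (fun k' (A' : astate R) => forall i j, (i < n)%N -> (j < n)%N ->
    (i < k)%N || ((i == k) && (j < k')%N) -> an A' vsets (i * n + j)%N = an A2 vS j) => //.
  + by move=> i j hi hj; rewrite andbF orbF; exact: IS.
  + move=> k' A4 kn' ik' f' IS'.
    have ik4 : an A4 vi 0%N = k by rewrite (proj1 f' vi isT).
    have eS : an A4 vS = an A2 vS by rewrite (proj1 f' vS isT) (proj1 f vS isT).
    store; rewrite ik4 ik' eS => i j hi hj; rewrite updE entry_eq //.
    case: ifP => [/andP[/eqP-> /eqP->]//|ne h]; apply: IS' => //.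
    case/orP: h => [->//|/andP[/eqP E lt]]; rewrite E eqxx /= in ne *.
    by move: lt; rewrite ltnS leq_eqVlt ne /= => ->; rewrite orbT.
  + move=> A4 f' IS' i j hi hj; rewrite ltnS leq_eqVlt => h; apply: IS' => //.
    by rewrite hj andbT orbC.
move=> A3 f3 IS; store.
have ec3 j : ar A3 xcost j = 0 by rewrite (proj2 f3 xcost isT); exact: ec1.
have ez3 j : ar A3 xz j = 0 by rewrite (proj2 f3 xz isT); exact: ez1.
have em3 : an A3 vm = an A1 vm by rewrite (proj1 f3 vm isT).
have eS3 : aset n A3 vS 0 = S by rewrite -(aset_setS A1 vS S) /aset (proj1 f3 vS isT).
have act0 : active n L (an A1 vm) = n.
  rewrite /active; under eq_bigr do rewrite em1 M0.
  by rewrite sum_nat_const card_ord muln1.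
split=> /=.
- by rewrite (proj2 f3 xdelta isT).
- by rewrite (proj1 f3 vN isT).
- by rewrite (proj1 f3 vM isT).
- move=> i; rewrite (proj2 f3 xy isT) em3 em1 /weight_of M0 expr0.
  exact: I1.
- by rewrite em3 act0.
- by rewrite /aset /= -/(aset n A3 vS 0) eS3.
- exists 0.
    (* The matrix of all slacks is its own inverse, hence equal to the content of [xB]. *)
    exists (-1)%:M; split.
    + apply/matrixP => i j; rewrite mul_mx_scalar !mxE (proj2 f3 xB isT) I2 //.
      rewrite ltn_ord /= -val_eqE /=.
      by case: eqP; rewrite ?mulr0 // mulN1r opprK.
    + move=> l; split.
        have -> // : aset n (setN A3 vact 0 n) vsets (l * n) = S.
        rewrite -eS3; apply/setP => j; rewrite !inE /= IS // add0n.
        by rewrite (proj1 f3 vS isT).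
      right; split; first exact: ec3.
      exists l; apply/colP => i; rewrite !mxE eqxx andbT.
      by case: eqP => // _; rewrite oppr0.
    + by move=> l; rewrite /= ez3.
    + have -> : cvec n (setN A3 vact 0 n) xz = 0.
        by apply/colP => l; rewrite !mxE /= ez3.
      by rewrite mulmx0; apply/colP => i; rewrite !mxE em3 em1.
    + by rewrite big1 // => l _; rewrite /= ec3 mul0r.
  apply: cost_bound_ext (cost_bound_init OPT delta_range L_large) => i.
  by rewrite em3 em1.
Qed.

Lemma update_spec A :
  let m' i := (an A vm i + an A vstep 0 * an A vS i)%N in
  run update A (fun A' =>
   [/\ forall i, (i < n)%N -> an A' vm i = m' i,
       forall i, (i < n)%N -> ar A' xa i = (an A vS i)%:R,
       forall i, (i < n)%N -> ar A' xy i = if (an A vM 0 <= m' i)%N then 0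
          else ar A xy i * (1 - (an A vS i)%:R / (an A vN 0%N)%:R) &
       an A' vact 0%N = (\sum_(i < n) (m' i < an A vM 0))%N]).
Proof.
move=> m'; seq; store.
loop (fun k A' =>
   [/\ forall i, an A' vm i = if (i < k)%N then m' i else an A vm i,
       forall i, (i < k)%N -> ar A' xa i = (an A vS i)%:R,
       forall i, ar A' xy i = if (i < k)%N then
          (if (an A vM 0 <= m' i)%N then 0
          else ar A xy i * (1 - (an A vS i)%:R / (an A vN 0%N)%:R)) else ar A xy i &
       an A' vact 0%N = (\sum_(i < k) (m' i < an A vM 0))%N]) => //.
- by rewrite big_ord0.
- move=> k A1 kn ik f [I1 I2 I3 I4].
  have es : an A1 vstep = an A vstep by rewrite (proj1 f vstep isT).
  have eS : an A1 vS = an A vS by rewrite (proj1 f vS isT).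
  have eM : an A1 vM = an A vM by rewrite (proj1 f vM isT).
  have eN : an A1 vN = an A vN by rewrite (proj1 f vN isT).
  seq; store; seq; store; seq; store.
  have ltk i : (i < k.+1)%N = (i == k) || (i < k)%N by rewrite ltnS leq_eqVlt.
  branch; rewrite ik updE eqxx es eS eM I1 ltnn -/(m' k) => h; store;
    rewrite ?ik ?es ?eS ?eN ?I3 ?ltnn ?I1 ?ltnn -/(m' k); split.
  + by move=> i; rewrite updE I1 ltk; case: eqP => [->|].
  + by move=> i; rewrite updE ltk; case: eqP => [->|] //= _ /I2.
  + move=> i; rewrite !updE ltk I3; case: eqP => [->|] //=; by rewrite h.
  + by rewrite I4 big_ord_recr /= ltnNge h addn0.
  + by move=> i; rewrite updE I1 ltk; case: eqP => [->|].
  + by move=> i; rewrite updE ltk; case: eqP => [->|] //= _ /I2.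
  + move=> i; rewrite !updE ltk I3; case: eqP => [->|] //=; by rewrite (negbTE h).
  + by rewrite I4 big_ord_recr /= ltnNge h.
- move=> A1 f [I1 I2 I3 I4]; split=> // i lt; first by rewrite I1 lt.
  by rewrite I3 lt.
Qed.

Definition remaining (A : astate R) : nat := (\sum_(i < n) (M - an A vm i))%N.

Lemma basis_ext (A A' : astate R) b C :
  an A' vsets = an A vsets -> ar A' xB = ar A xB -> ar A' xcost = ar A xcost ->
  ar A' xz = ar A xz -> basis F c A b C -> basis (n := n) F c A' b C.
Proof.
by move=> e1 e2 e3 e4 [B hB]; exists B; rewrite /binv /cvec /aset e1 e2 e3 e4.
Qed.

Lemma main_spec A : inv A -> evB n A main_test ->
  run main_body A (fun A' => inv A' /\ (remaining A' < remaining A)%N).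
Proof.
move=> [ed eN eM ey ea _ [C hB hC]]; rewrite /= => act1.
set m := an A vm in ey ea hB hC.
have M0 := M_gt0 delta_range L_large.
seq; apply: (query (m := m)) => // S SF hw.
have [i0 i0S i0M] : exists2 i, i \in S & (m i < M)%N.
  by apply: (covers_active cost_range delta_range L_large SF) hw; rewrite -ea.
set A1 := setS A vS S.
have S1 : aset n A1 vS 0 = S by exact: aset_setS.
seq; apply: run_cost => //; rewrite S1 //; set A2 := setR A1 _ _ _.
seq; apply: (run_conseq (Q := fun A' => an A' vstep 0%N = step n delta L m)).
  have e1 : an A2 vact 0%N = active n L m by [].
  have e2 : ar A2 xdelta 0%N = delta by [].
  have e3 : an A2 vM 0%N = M by [].
  by branch; rewrite ed ea /step => h; store; rewrite ?h ?(negbTE h).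
move=> A3 f3 es.
seq; apply: run_conseq; first exact: update_spec.
move=> A4 f4 [I1 I2 I3 I4].
have em3 : an A3 vm = m by rewrite (proj1 f3 vm isT).
have eM3 : an A3 vM 0%N = M by rewrite (proj1 f3 vM isT).
have eN3 : an A3 vN 0%N = (2 ^ L)%N by rewrite (proj1 f3 vN isT).
have eS3 (i : 'I_n) : an A3 vS i = (i \in S).
  by rewrite (proj1 f3 vS isT); exact: (setS_in A vS S i).
have ey3 (i : 'I_n) : ar A3 xy i = wt (m i) by rewrite (proj2 f3 xy isT) /= ey.
have es4 : an A4 vstep 0%N = step n delta L m by rewrite (proj1 f4 vstep isT).
have {}I1 (i : 'I_n) : an A4 vm i = (m i + step n delta L m * (i \in S))%N.
  by rewrite I1 // em3 es eS3.
seq; store; rewrite es4; set A5 := setR _ _ _ _.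
have hB5 : basis F c A5 (\col_i (m i)%:R) C.
  apply: basis_ext hB; rewrite /=.
  - by rewrite (proj1 f4 vsets isT) (proj1 f3 vsets isT).
  - by rewrite (proj2 f4 xB isT) (proj2 f3 xB isT).
  - by rewrite (proj2 f4 xcost isT) (proj2 f3 xcost isT).
  - by rewrite (proj2 f4 xz isT) (proj2 f3 xz isT).
have S5 : aset n A5 vS 0 = S.
  by rewrite -[RHS]S1 /aset /= (proj1 f4 vS isT) (proj1 f3 vS isT).
have ca5 : ar A5 xca 0%N = c S.
  by rewrite /= (proj2 f4 xca isT) (proj2 f3 xca isT).
have a5 : cvec n A5 xa = \col_i (i \in S)%:R.
  by apply/colP => i; rewrite !mxE /= I2 // eS3.
apply: run_conseq.
  apply: (absorb_spec _ _ _ _ n_gt0 hB5); last by rewrite /= ler0n.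
  rewrite S5 ca5 a5; split=> //; left; split=> //.
  by case/andP: (cost_range SF).
move=> A6 f6; rewrite a5 ca5 /= => hB6.
have m6 (i : 'I_n) : an A6 vm i = (m i + step n delta L m * (i \in S))%N.
  by rewrite (proj1 f6 vm isT) I1.
split; last first.
  rewrite /remaining (bigD1 i0) //= [X in (_ < X)%N](bigD1 i0) //=.
  rewrite m6 i0S muln1 -addSn leq_add //.
    by rewrite ltn_sub2l // -[X in (X < _)%N]addn0 ltn_add2l step_gt0.
  by apply: leq_sum => i _; rewrite m6 leq_sub2l // leq_addr.
split.
- by rewrite (proj2 f6 xdelta isT) /= (proj2 f4 xdelta isT) (proj2 f3 xdelta isT).
- by rewrite (proj1 f6 vN isT) /= (proj1 f4 vN isT) (proj1 f3 vN isT).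
- by rewrite (proj1 f6 vM isT) /= (proj1 f4 vM isT) (proj1 f3 vM isT).
- move=> i; rewrite (proj2 f6 xy isT) /= I3 // em3 es eS3 eM3 eN3 ey3 m6.
  rewrite /weight_of; case: (boolP (i \in S)) => iS; last first.
    by rewrite muln0 addn0 mul0r subr0 mulr1 leqNgt; case: ltnP.
  rewrite muln1 leqNgt; case: ltnP => //=; rewrite /step.
  case: ifP => _; first by rewrite ltnNge leq_addl.
  by rewrite addn1 => h; rewrite (ltnW h) exprSr mul1r.
- rewrite (proj1 f6 vact isT) /= I4; apply: eq_bigr => i _.
  by rewrite m6 em3 es eS3 eM3.
- have -> : aset n A6 vS 0 = S by rewrite -[RHS]S5 /aset (proj1 f6 vS isT).
  by [].
- exists (C + (step n delta L m)%:R * c S).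
    have -> // : \col_i (an A6 vm i)%:R =
      \col_i (m i)%:R + (step n delta L m)%:R *: \col_(i < n) (i \in S)%:R :> 'cV[R]_n.
    by apply/colP => i; rewrite !mxE m6 natrD natrM.
  apply: (cost_bound_step cost_range OPT_range delta_range L_large SF m6) hC => //.
  by exists i0.
Qed.

Lemma finish_spec A : inv A -> ~~ evB n A main_test ->
  run finish A (fun A' =>
    (forall l, (l < n)%N -> aset n A' vsets (l * n) \in F) /\
    let x := \col_j \sum_(l < n | aset n A' vsets (l * n) == member j) ar A' xz l in
    basic_solution (cover_mx R F) (cover_rhs R F) x /\
    lp_cost (cost_vec F c) x <= OPT + delta).
Proof.
move=> [ed eN eM _ ea SF [C hB hC]]; rewrite /= -leqNgt leqn0 => /eqP a0.
have M0 := M_gt0 delta_range L_large.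
have C1 : C <= M%:R * (OPT + delta).
  by apply: (cost_bound_final delta_range) hC; rewrite -ea.
set m := an A vm in ea hB hC.
have mM (i : 'I_n) : (M <= m i)%N.
  have /eqP : active n L m = 0%N by rewrite -ea.
  rewrite /active sum_nat_eq0 => /forallP /(_ i) /=.
  by case: ltnP.
(* Absorbing [m i - M] copies of the free column [- e_i] trims the count of [i] to exactly [M]
   without raising the cost bound. *)
seq; loop (fun k (A' : astate R) =>
   basis F c A' (\col_(i < n) (if (i < k)%N then M else m i)%:R) C) => //.
- move=> k A1 kn ik f hB1.
  have eM1 : an A1 vM 0%N = M by rewrite (proj1 f vM isT).
  have em1 : an A1 vm = m by rewrite (proj1 f vm isT).
  have eS1 : an A1 vS = an A vS by rewrite (proj1 f vS isT).
  seq; loop (fun k' (A' : astate R) => forall j, (j < k')%N -> ar A' xa j = 0) => //.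
    move=> k' A2 kn' ik' f' Ia; store; rewrite ik' => j; rewrite updE ltnS leq_eqVlt.
    by case: eqP => [//|_] /Ia.
  move=> A2 f2 Ia.
  have ik2 : an A2 vi 0%N = k by rewrite (proj1 f2 vi isT).
  have em2 : an A2 vm = m by rewrite (proj1 f2 vm isT).
  have eM2 : an A2 vM 0%N = M by rewrite (proj1 f2 vM isT).
  seq; store; seq; store; seq; store; rewrite ik2 em2 eM2.
  set A3 := setR _ xalpha _ _.
  have hB3 : basis F c A3 (\col_(i < n) (if (i < k)%N then M else m i)%:R) C.
    apply: basis_ext hB1; rewrite /=.
    - by rewrite (proj1 f2 vsets isT).
    - by rewrite (proj2 f2 xB isT).
    - by rewrite (proj2 f2 xcost isT).
    - by rewrite (proj2 f2 xz isT).
  pose i1 := Ordinal kn.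
  have a3 : cvec n A3 xa = - delta_mx i1 0.
    apply/colP => i; rewrite !mxE /= updE andbT -val_eqE /=.
    by case: eqP => _; rewrite ?sub0r // Ia // oppr0.
  apply: run_conseq.
    apply: (absorb_spec _ _ _ _ n_gt0 hB3); last by rewrite /= ler0n.
    split; last by right; split=> //; exists i1.
    by rewrite /aset /= (proj1 f2 vS isT) eS1.
  move=> A4 f4; rewrite a3 /= mulr0 addr0 => hB4.
  apply: (basis_ext erefl erefl erefl erefl (A := A4)).
  have <- : \col_(i < n) (if (i < k)%N then M else m i)%:R +
      (m k - M)%:R *: - delta_mx i1 0 = \col_(i < n) (if (i < k.+1)%N then M else m i)%:R
      :> 'cV[R]_n.
    apply/colP => i; rewrite !mxE andbT -val_eqE /= ltnS [in RHS]leq_eqVlt.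
    case: eqP => [->|_] /=; last by rewrite mulr0n oppr0 mulr0 addr0.
    by rewrite ltnn mulr1n mulrN1 natrB ?opprB ?(mM i1) // addrC subrK.
  exact: hB4.
move=> A1 f1 [B [BB Bc z0 Bz Cz]].
have eM1 : an A1 vM 0%N = M by rewrite (proj1 f1 vM isT).
loop (fun k (A' : astate R) => forall l, ar A' xz l =
  if (l < k)%N then (if ar A1 xcost l <= 0 then 0 else ar A1 xz l / M%:R)
  else ar A1 xz l) => //.
- move=> k A2 kn ik f Iz.
  have ec : ar A2 xcost = ar A1 xcost by rewrite (proj2 f xcost isT).
  have eM2 : an A2 vM 0%N = M by rewrite (proj1 f vM isT).
  branch; rewrite ik ec => h; store; rewrite ik => l;
    rewrite updE ltnS leq_eqVlt ?eM2 !Iz ?ltnn; case: eqP => [->|_] //=.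
    by rewrite h.
  by rewrite (negbTE h).
- move=> A2 f2 Iz.
  have es : an A2 vsets = an A1 vsets by rewrite (proj1 f2 vsets isT).
  have eA l : aset n A2 vsets l = aset n A1 vsets l by rewrite /aset es.
  split=> [l ln|]; first by rewrite eA; case: (Bc (Ordinal ln)).
  set x := \col_j _.
  have MR : 0 < M%:R :> R by rewrite ltr0n.
  have Bz' : B *m (\col_l ar A1 xz l) = const_mx M%:R.
    have := Bz; rewrite /cvec => ->; apply/colP => i.
    by rewrite !mxE ltn_ord.
  have -> : x = \col_j \sum_(l < n | aset n A1 vsets (l * n) == member j)
      (if ar A1 xcost l <= 0 then 0 else ar A1 xz l / M%:R).
    apply/colP => j; rewrite !mxE; apply: eq_big => [l|l _]; first by rewrite eA.
    by rewrite Iz ltn_ord.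
  split; first exact: (basis_basic MR BB Bc z0 Bz').
  rewrite (basis_cost _ _ Bc).
  by rewrite ler_pdivrMr // mulrC (le_trans Cz).
Qed.

End Main.

(** * Running time *)

(** The five times are those of the pieces of [program]. With [P = n * M] bounding the rounds, each
    is compared with [P * n ^ 2] and [P * T]; cost calls are absorbed through
    [tc <= K * n <= K * n ^ 2]. *)
Lemma time_sum (a1 a2 a3 a4 a5 b2 b4 K n L M tc T t1 t2 t3 t4 t5 : nat) :
  (0 < n)%N -> (0 < M)%N -> (L <= M)%N -> (tc <= K * n)%N ->
  (t1 <= a1)%N ->
  (t2 <= L.+1 * (a2 + b2.+1))%N ->
  (t3 <= a3 * n ^ 2 + (tc + T))%N ->
  (t4 <= (n * M).+1 * (a4 * n ^ 2 + 2 * (tc + T) + b4.+1))%N ->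
  (t5 <= a5 * n ^ 3)%N ->
  (t1 + (t2 + (t3 + (t4 + t5))) <=
   (a1 + 2 * (a2 + b2) + a3 + 2 * (a4 + b4) + a5 + 10) * K.+1 * (n * M) *
   (T + n ^ 2))%N.
Proof.
move=> n0 M0 LM htc h1 h2 h3 h4 h5.
set P := (n * M)%N in h4 *; set q := (n ^ 2)%N in h3 h4 *.
have nP : (n <= P)%N by rewrite leq_pmulr.
have LP : (L <= P)%N by rewrite (leq_trans LM) // leq_pmull.
have P1 : (1 <= P)%N by rewrite (leq_trans n0).
have nq : (n <= q)%N by rewrite /q expnS expn1 leq_pmulr.
have q1 : (1 <= q)%N by rewrite (leq_trans n0).
have htq : (tc <= K * q)%N by rewrite (leq_trans htc) // leq_mul2l nq orbT.
have cub : (n ^ 3 <= P * q)%N by rewrite expnS leq_mul2r nP orbT.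
have PqP : (P <= P * q)%N by rewrite leq_pmulr.
have Pq1 : (1 <= P * q)%N by rewrite (leq_trans P1).
have g1 : (t1 <= a1 * (P * q))%N by rewrite (leq_trans h1) // leq_pmulr.
have g2 : (t2 <= 2 * (a2 + b2.+1) * (P * q))%N.
  apply: leq_trans h2 _; rewrite [(2 * _)%N]mulnC -mulnA [(L.+1 * _)%N]mulnC leq_mul2l.
  by apply/orP; right; lia.
have g3 : (t3 <= (a3 + K) * (P * q) + P * T)%N.
  apply: leq_trans h3 _; rewrite mulnDl -addnA leq_add //.
    by rewrite leq_mul2l; apply/orP; right; rewrite leq_pmull.
  apply: leq_add; last by rewrite leq_pmull.
  by rewrite (leq_trans htq) // leq_mul2l leq_pmull ?orbT.
have g4 : (t4 <= 2 * (a4 + 2 * K + b4.+1) * (P * q) + 4 * (P * T))%N.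
  apply: leq_trans h4 _.
  apply: (@leq_trans (2 * P * (a4 * q + 2 * (K * q + T) + b4.+1 * q))%N).
    apply: leq_mul; first lia.
    by rewrite leq_add ?leq_add ?leq_mul ?leq_add ?leq_pmulr.
  by apply: eq_leq; ring.
have g5 : (t5 <= a5 * (P * q))%N by rewrite (leq_trans h5) // leq_mul2l cub orbT.
set X := (P * q)%N in g1 g2 g3 g4 g5; set Y := (P * T)%N in g3 g4.
have -> : ((a1 + 2 * (a2 + b2) + a3 + 2 * (a4 + b4) + a5 + 10) * K.+1 * P * (T + q) =
  (a1 + 2 * (a2 + b2) + a3 + 2 * (a4 + b4) + a5 + 10) * K.+1 * X +
  (a1 + 2 * (a2 + b2) + a3 + 2 * (a4 + b4) + a5 + 10) * K.+1 * Y)%N.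
  by rewrite /X /Y; ring.
apply: (@leq_trans ((a1 + 2 * (a2 + b2.+1) + (a3 + K) +
    2 * (a4 + 2 * K + b4.+1) + a5) * X + 5 * Y)%N).
  by rewrite !mulnDl in g1 g2 g3 g4 g5 *; lia.
apply: leq_add; rewrite leq_mul2r; apply/orP; right; last by lia.
by rewrite mulnS; nia.
Qed.

Definition time_const (K : nat) : nat :=
  ((tcoef start + 2 * (tcoef scale_body + btime (compB scale_test)) +
    tcoef setup + 2 * (tcoef main_body + btime (compB main_test)) +
    tcoef finish + 10) * K.+1)%N.

(** * The number of rounds *)

Section Rounds.

Variables (R : realType) (n : nat) (delta : R).
Hypothesis delta_range : 0 < delta <= n%:R / 2.

Lemma scale_exists : exists k, 16 * n%:R <= 2 ^+ k * delta.
Proof.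
case/andP: delta_range => d0 d1.
have x0 : 0 <= 16 * n%:R / delta by rewrite divr_ge0 ?mulr_ge0 // ltW.
exists (Num.bound (16 * n%:R / delta)); rewrite -ler_pdivrMr //.
apply: le_trans (ltW (archi_boundP x0)) _.
by rewrite -natrX ler_nat ltnW // ltn_expl.
Qed.

Lemma ln_ge_half (x : R) : 2 <= x -> 2^-1 <= ln x.
Proof.
move=> x2; rewrite -ler_expR lnK ?posrE; last by lra.
apply: le_trans x2; set E := expR 2^-1.
have E0 : 0 < E by exact: expR_gt0.
have : (1 + - 2^-1) * E <= E^-1 * E by rewrite ler_pM2r // /E -expRN expR_ge1Dx.
rewrite mulVf ?gt_eqF //; lra.
Qed.

(** With [r = n / delta >= 2], minimality of [L] gives [2 ^ (L - 1) < 16 * r], so [N <= 32 * r].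
    Taking logarithms, [(L - 1) * ln 2 <= 5 * ln r] because [16 <= r ^ 4]; as [ln 2 >= 1/2], this
    yields [L - 1 <= 10 * ln r], and [1 <= 2 * ln r] gives the [12]. *)
Lemma rounds_bound (L : nat) : (0 < L)%N ->
  (forall k, (k < L)%N -> 2 ^+ k * delta < 16 * n%:R) ->
  (n * threshold L)%:R <= 32 * 32 * 12 * (n%:R ^+ 3 / delta ^+ 2 * ln (n%:R / delta)) :> R.
Proof.
case: L => // k _ /(_ k (ltnSn k)); case/andP: delta_range => d0 d1 h.
have n0 : 0 < n%:R :> R by lra.
set r := n%:R / delta; have rE : r = n%:R / delta by [].
clearbody r.
have r2 : 2 <= r by rewrite rE ler_pdivlMr //; lra.
have hr : 2 ^+ k <= 16 * r by rewrite rE mulrA ler_pdivlMr // ltW.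
have N_le : 2 ^+ k.+1 <= 32 * r by rewrite exprS; lra.
have N0 : 0 <= 2 ^+ k.+1 :> R by rewrite exprn_ge0.
have L_le : k.+1%:R <= 12 * ln r.
  have l2 := ln_ge_half (lexx 2 : (2 : R) <= 2).
  have lr : ln 2 <= ln r by rewrite ler_ln ?posrE //; lra.
  have : ln (2 ^+ k) <= ln (2 ^+ 4 * r).
    rewrite ler_ln ?posrE ?exprn_gt0 ?mulr_gt0 ?exprn_gt0 //; last by lra.
    by have -> : 2 ^+ 4 = 16 :> R by rewrite -natrX.
  rewrite lnM ?posrE ?exprn_gt0 //; last by lra.
  rewrite !lnXn // -[_ *+ k]mulr_natl -[_ *+ 4]mulr_natl => hk.
  have {}hk : k%:R * ln 2 <= 5 * ln r by clear - hk lr; lra.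
  have kl : k%:R * 2^-1 <= k%:R * ln 2 :> R by rewrite ler_wpM2l.
  by rewrite -natr1; clear - hk kl l2 lr; lra.
rewrite !natrM !natrX.
have -> : 32 * 32 * 12 * (n%:R ^+ 3 / delta ^+ 2 * ln r) = n%:R * (32 * r * (32 * r) * (12 * ln r)).
  by rewrite rE; field; rewrite gt_eqF.
rewrite ler_wpM2l ?ler0n // ler_pM ?mulr_ge0 ?ler0n //.
by rewrite ler_pM.
Qed.

End Rounds.

Theorem theorem18 (R : realType) :
  exists (prog : com) (c0 : R), 0 < c0 /\
  forall K : nat, exists2 C : R, 0 < C &
  forall (n : nat) (F : {set {set 'I_n}}) (c : {set 'I_n} -> R)
         (T : nat -> R -> nat) (tc : nat)
         (opt : 'rV[rat]_n -> R -> {set 'I_n}) (OPTf delta : R),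
    (forall S, S \in F -> 0 < c S <= 1) ->
    (tc <= K * n)%N ->
    optimizer F c opt ->
    lp_minimum (cover_mx R F) (cover_rhs R F) (cost_vec F c) OPTf ->
    0 < delta <= n%:R / 2 ->
    exists (st : state R) (t : nat) (x : 'cV[R]_#|F|),
      [/\ exec F c tc T opt prog (input_state n delta) st t,
          t%:R <= C * (n%:R ^+ 4 / delta ^+ 2 * ln (n%:R / delta)) *
                  (delta^-1 * (T n (c0 * delta / n%:R))%:R + n%:R ^+ 2),
          outputs st x,
          basic_solution (cover_mx R F) (cover_rhs R F) x &
          lp_cost (cost_vec F c) x <= OPTf + delta].
Proof.
exists program, (16^-1); split; first by rewrite invr_gt0.
move=> K; exists ((time_const K)%:R * (32 * 32 * 12)).
  have D0 : (0 < time_const K)%N by rewrite /time_const muln_gt0 addnS.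
  by rewrite !mulr_gt0 // ltr0n.
move=> n F c T tc opt OPT delta hc htc hopt hOPT hd.
have /andP[d0 d1] := hd.
have n_gt0 : (0 < n)%N by rewrite lt0n; apply: contraTneq d1 => ->; rewrite -ltNge mul0r.
have n1 : 1 <= n%:R :> R by rewrite ler1n.
set e := 16^-1 * delta / n%:R.
have [L hL hmin] := ex_minnP (scale_exists hd).
have least k : (k < L)%N -> 2 ^+ k * delta < 16 * n%:R.
  by move=> kL; rewrite ltNge; apply: contraTN kL => /hmin; rewrite -leqNgt.
have L0 := L_gt0 hd hL; have M0 := M_gt0 hd hL.
have r0 := rep_input delta n_gt0.
have [s1 [t1 [A1 [x1 l1 r1 _ I1]]]] :=
  start_spec F c tc T opt L n_gt0 r0.
have ok2 A : scaling delta L A -> okB n A scale_test.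
  by move=> _; rewrite /= size_gt0.
have [s2 [t2 [A2 [x2 l2 r2 I2 stop2]]]] := run_while n_gt0 ok2
  (fun A IA eb => scale_spec F c tc T opt n_gt0 hd hL IA eb) I1 r1.
have eL2 : an A2 vL 0%N = L.
  apply/eqP; rewrite eqn_leq (scalingL I2) /=; apply: hmin.
  have /negPn := stop2; by rewrite /= (scalingN I2) (scaling_delta I2) natrX.
have [s3 [t3 [A3 [x3 l3 r3 _ I3]]]] :=
  setup_spec tc T n_gt0 hc hopt hOPT hd hL I2 eL2 r2.
have ok4 A : inv F c OPT delta L A -> okB n A main_test.
  by move=> _; rewrite /= size_gt0.
have [s4 [t4 [A4 [x4 l4 r4 I4 stop4]]]] := run_while n_gt0 ok4
  (fun A IA eb => main_spec tc T n_gt0 hc hopt hOPT hd hL IA eb) I3 r3.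
have [s5 [t5 [A5 [x5 l5 r5 _ [entF [basic cost]]]]]] :=
  finish_spec tc T opt n_gt0 hd hL I4 stop4 r4.
exists s5, (t1 + (t2 + (t3 + (t4 + t5))))%N.
exists (\col_j \sum_(l < n | aset n A5 vsets (l * n) == member j) ar A5 xz l).
split=> //.
- by do 4 (apply: ExecSeq; first eassumption).
- have ht : (t1 + (t2 + (t3 + (t4 + t5))) <=
      time_const K * (n * threshold L) * (T n e + n ^ 2))%N.
    apply: (time_sum n_gt0 M0 _ htc (L := L)).
    + by rewrite /threshold leq_pmull // muln_gt0 expn_gt0.
    + by rewrite (leq_trans l1) // /tbound muln1 addn0.
    + apply: leq_trans l2 _; rewrite /tbound muln1 addn0 leq_mul2r ltnS leq_subr.
      by rewrite orbT.
    + by apply: leq_trans l3 _; rewrite /tbound mul1n.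
    + apply: leq_trans l4 _; rewrite /tbound leq_mul2r; apply/orP; right.
      rewrite ltnS /remaining -[X in (_ <= X * _)%N]card_ord -sum_nat_const.
      by apply: leq_sum => i _; rewrite leq_subr.
    + by rewrite (leq_trans l5) // /tbound addn0.
  have {}ht : (t1 + (t2 + (t3 + (t4 + t5))))%:R <=
      (time_const K)%:R * (n * threshold L)%:R * ((T n e)%:R + n%:R ^+ 2) :> R.
    by rewrite -natrX -natrD -!natrM ler_nat.
  apply: le_trans ht _; rewrite -mulrA.
  suff key : (n * threshold L)%:R * ((T n e)%:R + n%:R ^+ 2) <=
      32 * 32 * 12 * (n%:R ^+ 4 / delta ^+ 2 * ln (n%:R / delta)) *
      (delta^-1 * (T n e)%:R + n%:R ^+ 2).
    by apply: le_trans (ler_wpM2l (ler0n _ _) key) _; rewrite !mulrA.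
  have hr := rounds_bound hd L0 least.
  have ln0 : 0 <= ln (n%:R / delta).
    apply: le_trans (ln_ge_half _); first by rewrite invr_ge0.
    by rewrite ler_pdivlMr //; lra.
  have X0 : 0 <= n%:R ^+ 3 / delta ^+ 2 * ln (n%:R / delta).
    by rewrite mulr_ge0 // divr_ge0 // exprn_ge0 // ltW.
  have Y0 : 0 <= (T n e)%:R + n%:R ^+ 2 :> R by rewrite addr_ge0 ?exprn_ge0.
  apply: le_trans (ler_wpM2r Y0 hr) _.
  rewrite -!(mulrA (32 * 32 * 12)); apply: ler_wpM2l; first by rewrite !mulr_ge0.
  set X := _ * ln _ in X0 *.
  have -> : n%:R ^+ 4 / delta ^+ 2 * ln (n%:R / delta) = n%:R * X.
    by rewrite /X exprS -!mulrA.
  rewrite [n%:R * X]mulrC -(mulrA X n%:R); apply: ler_wpM2l => //.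
  (* The spare factor [n] is spent here: [T <= n / delta * T] and [n ^ 2 <= n * n ^ 2]. *)
  rewrite mulrDr; apply: lerD.
    rewrite mulrA ler_peMl // ler_pdivlMr //; lra.
  by rewrite ler_peMl ?exprn_ge0.
(* [vsets] and [xz] both have name [0], so their blocks start at the cells [1] and [0] prescribed
   for the output, and cell [0], which still contains [n], is the number of entries. *)
- have [e0 eN eR] := r5.
  have eE l : (l < n)%N -> read_set n (nmem s5) (1 + l * n)%N = aset n A5 vsets (l * n).
    move=> ln; rewrite -(read_setE vsets r5) ?mul0n ?addn0 //.
    by rewrite addnC -mulSn leq_mul2r ln orbT.
  rewrite /outputs e0; split=> [l ln|j]; first by rewrite eE // entF.
  rewrite mxE; apply: eq_big => [l|l _]; first by rewrite eE.
  by rewrite -eR ?mul0n // ltn_size.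
Qed.
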